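(* Let $s,x\in\mathbb{R}^6$ with $|x|<|s|$. Then the following expansions hold: $$S^{-1}_{\mathcal{D},L}(s,x)=-4\sum_{m=1}^\infty\sum_{k=1}^mx^{m-k}\overline{x}^{k-1}s^{-1-m},\qquad S^{-1}_{\mathcal{D},R}(s,x)=-4\sum_{m=1}^\infty\sum_{k=1}^ms^{-1-m}x^{m-k}\overline{x}^{k-1};$$ $$S^{-1}_{\Delta,L}(s,x)=-8\sum_{m=2}^\infty\sum_{k=1}^{m-1}(m-k)x^{m-k-1}\overline{x}^{k-1}s^{-1-m},\qquad S^{-1}_{\Delta,R}(s,x)=-8\sum_{m=2}^\infty\sum_{k=1}^{m-1}(m-k)s^{-1-m}x^{m-k-1}\overline{x}^{k-1};$$ $$S^{-1}_{\Delta\mathcal{D},L}(s,x)=16\sum_{m=3}^\infty\sum_{k=1}^{m-2}(m-k-1)k\,x^{m-k-2}\overline{x}^{k-1}s^{-1-m},\qquad S^{-1}_{\Delta\mathcal{D},R}(s,x)=16\sum_{m=3}^\infty\sum_{k=1}^{m-2}(m-k-1)k\,s^{-1-m}x^{m-k-2}\overline{x}^{k-1};$$ $$S^{-1}_{\mathcal{D}^2,L}(s,x)=-8\sum_{m=2}^\infty\sum_{k=1}^{m-1}k\,x^{m-k-1}\overline{x}^{k-1}s^{-1-m},\qquad S^{-1}_{\mathcal{D}^2,R}(s,x)=-8\sum_{m=2}^\infty\sum_{k=1}^{m-1}k\,s^{-1-m}x^{m-k-1}\overline{x}^{k-1};$$ $$S^{-1}_{\overline{\mathcal{D}},L}(s,x)=2\sum_{m=1}^\infty\Big(mx^{m-1}+2\sum_{k=1}^mx^{m-k}\overline{x}^{k-1}\Big)s^{-1-m},\qquad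 S^{-1}_{\overline{\mathcal{D}},R}(s,x)=2\sum_{m=1}^\infty s^{-1-m}\Big(mx^{m-1}+2\sum_{k=1}^mx^{m-k}\overline{x}^{k-1}\Big);$$ $$S^{-1}_{\overline{\mathcal{D}}^2,L}(s,x)=4\sum_{m=2}^\infty\Big(m(m-1)x^{m-2}+2\sum_{k=1}^{m-1}(2m-k)x^{m-k-1}\overline{x}^{k-1}\Big)s^{-1-m},$$ $$S^{-1}_{\overline{\mathcal{D}}^2,R}(s,x)=4\sum_{m=2}^\infty s^{-1-m}\Big(m(m-1)x^{m-2}+2\sum_{k=1}^{m-1}(2m-k)x^{m-k-1}\overline{x}^{k-1}\Big);$$ $$S^{-1}_{\Delta\overline{\mathcal{D}},L}(s,x)=-16\sum_{m=3}^\infty\sum_{k=1}^{m-2}(m-k-1)(m+k)x^{m-k-2}\overline{x}^{k-1}s^{-1-m},$$ $$S^{-1}_{\Delta\overline{\mathcal{D}},R}(s,x)=-16\sum_{m=3}^\infty\sum_{k=1}^{m-2}(m-k-1)(m+k)s^{-1-m}x^{m-k-2}\overline{x}^{k-1}.$$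
   Context: $\mathbb{R}_5$ is the real Clifford algebra generated by $e_1,\dots,e_5$ with $e_i^2=-1$, $e_ie_j=-e_je_i$ for $i\ne j$. $\mathbb{R}^6$ is identified with paravectors $x=x_0+\underline{x}$, $\underline{x}=\sum_{i=1}^5x_ie_i$; $\overline{x}=x_0-\underline{x}$, $|x|^2=\sum_{i=0}^5x_i^2$. $\mathbb{S}=\{\underline{x}:|\underline{x}|=1\}$, $[s]=\{s_0+J|\underline{s}|:J\in\mathbb{S}\}$. For $x\notin[s]$: $\mathcal{Q}_{c,s}(x)=s^2-2x_0s+|x|^2$, $S_L^{-1}(s,x)=(s-\overline{x})\mathcal{Q}_{c,s}(x)^{-1}$, $S_R^{-1}(s,x)=\mathcal{Q}_{c,s}(x)^{-1}(s-\overline{x})$. All operators act in $x$: $\mathcal{D}f=\partial_{x_0}f+\sum_{i=1}^5e_i\partial_{x_i}f$, $\overline{\mathcal{D}}f=\partial_{x_0}f-\sum_{i=1}^5e_i\partial_{x_i}f$; right actions $f\mathcal{D}=\partial_{x_0}f+\sum_i(\partial_{x_i}f)e_i$, $f\overline{\mathcal{D}}=\partial_{x_0}f-\sum_i(\partial_{x_i}f)e_i$; $\Delta=\sum_{i=0}^5\partial_{x_i}^2$. For $\mathsf{P}\in\{\mathcal{D},\Delta,\Delta\mathcal{D},\mathcal{D}^2,\overline{\mathcal{D}},\overline{\mathcal{D}}^2,\Delta\overline{\mathcal{D}}\}$ the slice $\mathsf{P}$-kernels are $S^{-1}_{\mathsf{P},L}(s,x):=\mathsf{P}(S_L^{-1}(s,x))$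 and $S^{-1}_{\mathsf{P},R}(s,x):=(S_R^{-1}(s,x))\mathsf{P}$. *)

(* Defs.v *)
From HB Require Import structures.
From mathcomp Require Import all_boot all_order all_algebra.
From mathcomp Require Import all_classical all_reals all_analysis.

Set Implicit Arguments.
Unset Strict Implicit.
Unset Printing Implicit Defensive.

Import Order.TTheory GRing.Theory Num.Theory.
Import numFieldNormedType.Exports.
Local Open Scope ring_scope.

(* The real Clifford algebra generated by n units of square -1.  As a normed
   space it is R^(2^n); the coordinates are indexed by the subsets A of 'I_n,
   the basis vector of A being the product of the units e_i, i in A, taken in
   increasing order of i. *)
Definition clifford (R : realType) (n : nat) : Type := 'rV[R]_#|{set 'I_n}|.

HB.instance Definition _ (R : realType) (n : nat) :=
  NormedModule.copy (clifford R n) 'rV[R]_#|{set 'I_n}|.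
HB.instance Definition _ (R : realType) (n : nat) :=
  Complete.copy (clifford R n) 'rV[R]_#|{set 'I_n}|.

Section CliffordRing.
Variables (R : realType) (n : nat).
Local Notation C := (clifford R n).
Local Notation set0 := (@finset.set0 'I_n).
Implicit Types (a b c : C) (A B D : {set 'I_n}).

Definition blade A : C := delta_mx 0 (enum_rank A).
Definition coord a A : R := a 0 (enum_rank A).

Definition symdiff A B : {set 'I_n} := (A :\: B) :|: (B :\: A).

(* e_A e_B = csign A B *: e_(A symdiff B): sorting costs one sign for each
   i in A, j in B with j < i, and one sign e_i ^ 2 = -1 for each i = j. *)
Definition csign A B : R :=
  \prod_(i in A) \prod_(j in B | (j <= i)%N) (- 1).

Definition cmul a b : C :=
  \sum_A \sum_B (coord a A * coord b B * csign A B) *: blade (symdiff A B).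

Lemma in_symdiff A B i : (i \in symdiff A B) = (i \in A) (+) (i \in B).
Proof. by rewrite !finset.inE; case: (i \in A); case: (i \in B). Qed.

Lemma symdiffA A B D : symdiff A (symdiff B D) = symdiff (symdiff A B) D.
Proof. by apply/finset.setP => i; rewrite !in_symdiff addbA. Qed.

Lemma symdiff0s A : symdiff set0 A = A.
Proof. by apply/finset.setP => i; rewrite in_symdiff inE. Qed.

Lemma symdiffs0 A : symdiff A set0 = A.
Proof. by apply/finset.setP => i; rewrite in_symdiff inE addbF. Qed.

Lemma prod_symdiff (f : 'I_n -> R) A B : (forall i, f i * f i = 1) ->
  \prod_(i in symdiff A B) f i = (\prod_(i in A) f i) * \prod_(i in B) f i.
Proof.
move=> ff; rewrite !(big_mkcond (fun i => i \in _)) -big_split /=.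
apply: eq_bigr => i _; rewrite in_symdiff.
by case: (i \in A); case: (i \in B); rewrite /= ?mulr1 ?mul1r.
Qed.

Lemma csignsDl A B D : csign (symdiff A B) D = csign A D * csign B D.
Proof.
apply: prod_symdiff => i; rewrite -big_split /=.
by rewrite big1 // => j _; rewrite mulrNN mulr1.
Qed.

Lemma csignsDr A B D : csign A (symdiff B D) = csign A B * csign A D.
Proof.
rewrite /csign -big_split /=; apply: eq_bigr => i _.
rewrite !big_mkcondr /= prod_symdiff // => j.
by case: ifP => _; rewrite ?mulrNN mulr1.
Qed.

Lemma csign0s A : csign set0 A = 1.
Proof. by rewrite /csign finset.big_set0. Qed.

Lemma csigns0 A : csign A set0 = 1.
Proof.
by rewrite /csign big1 // => i _; rewrite big_pred0 // => j; rewrite finset.inE.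
Qed.

Lemma coord_blade A B : coord (blade A) B = (A == B)%:R.
Proof.
by rewrite /coord /blade mxE eqxx /= (inj_eq enum_rank_inj) eq_sym.
Qed.

Lemma cliffordE a : a = \sum_A coord a A *: blade A.
Proof.
rewrite [LHS]row_sum_delta (reindex (@enum_rank {set 'I_n})) //=.
by exists enum_val => i _; rewrite (enum_rankK, enum_valK).
Qed.

Lemma cmulDl : left_distributive cmul +%R.
Proof.
move=> a b c; rewrite /cmul -big_split; apply: eq_bigr => A _ /=.
rewrite -big_split; apply: eq_bigr => B _ /=.
by rewrite -scalerDl {1}/coord mxE -!mulrDl.
Qed.

Lemma cmulDr : right_distributive cmul +%R.
Proof.
move=> a b c; rewrite /cmul -big_split; apply: eq_bigr => A _ /=.
rewrite -big_split; apply: eq_bigr => B _ /=.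
by rewrite -scalerDl {2}/coord mxE -mulrDl -mulrDr.
Qed.

Lemma cmulZl (k : R) a b : k *: cmul a b = cmul (k *: a) b.
Proof.
rewrite /cmul scaler_sumr; apply: eq_bigr => A _ /=.
rewrite scaler_sumr; apply: eq_bigr => B _ /=.
by rewrite scalerA [coord (k *: a) A]mxE !mulrA.
Qed.

Lemma cmulZr (k : R) a b : k *: cmul a b = cmul a (k *: b).
Proof.
rewrite /cmul scaler_sumr; apply: eq_bigr => A _ /=.
rewrite scaler_sumr; apply: eq_bigr => B _ /=.
by rewrite scalerA [coord (k *: b) B]mxE !mulrA (mulrC k).
Qed.

Lemma cmul0l b : cmul 0 b = 0.
Proof. by rewrite -[X in cmul X](scale0r 0) -cmulZl scale0r. Qed.

Lemma cmul0r a : cmul a 0 = 0.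
Proof. by rewrite -[X in cmul _ X](scale0r 0) -cmulZr scale0r. Qed.

Lemma cmul_suml (I : finType) (F : I -> C) b :
  cmul (\sum_i F i) b = \sum_i cmul (F i) b.
Proof.
apply: (big_morph (cmul^~ b)) => [x y|]; first exact: cmulDl.
exact: cmul0l.
Qed.

Lemma cmul_sumr (I : finType) (F : I -> C) a :
  cmul a (\sum_i F i) = \sum_i cmul a (F i).
Proof.
apply: (big_morph (cmul a)) => [x y|]; first exact: cmulDr.
exact: cmul0r.
Qed.

Lemma cmul_blade A B :
  cmul (blade A) (blade B) = csign A B *: blade (symdiff A B).
Proof.
rewrite /cmul (bigD1 A) //= [X in _ + X]big1 ?addr0 => [|D /negPf DA]; last first.
  by rewrite big1 // => E _; rewrite coord_blade eq_sym DA !mul0r scale0r.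
rewrite (bigD1 B) //= [X in _ + X]big1 ?addr0 => [|D /negPf DB]; last first.
  by rewrite [coord _ D]coord_blade eq_sym DB mulr0 mul0r scale0r.
by rewrite !coord_blade !eqxx !mul1r.
Qed.

Lemma cmulA : associative cmul.
Proof.
have bladeA A B D : cmul (blade A) (cmul (blade B) (blade D)) =
                    cmul (cmul (blade A) (blade B)) (blade D).
  rewrite !cmul_blade -cmulZr -cmulZl !cmul_blade !scalerA symdiffA.
  by rewrite csignsDl csignsDr; congr (_ *: _); rewrite mulrC mulrA.
move=> a b c; rewrite [a]cliffordE.
rewrite [LHS]cmul_suml [cmul _ b]cmul_suml [RHS]cmul_suml.
apply: eq_bigr => A _; rewrite -[cmul _ b]cmulZl -[LHS]cmulZl -[RHS]cmulZl.
congr (_ *: _); rewrite [b]cliffordE.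
rewrite [cmul _ c]cmul_suml [LHS]cmul_sumr [X in cmul X c]cmul_sumr.
rewrite [RHS]cmul_suml; apply: eq_bigr => B _.
rewrite -[cmul (_ *: _) c]cmulZl -[cmul _ (_ *: blade B)]cmulZr -[LHS]cmulZr.
rewrite -[RHS]cmulZl; congr (_ *: _); rewrite [c]cliffordE.
rewrite [X in cmul _ X = _]cmul_sumr [LHS]cmul_sumr [RHS]cmul_sumr.
apply: eq_bigr => D _.
by rewrite -[X in cmul _ X = _]cmulZr -[LHS]cmulZr -[RHS]cmulZr bladeA.
Qed.

Lemma cmul1l : left_id (blade set0) cmul.
Proof.
move=> a; rewrite {1}[a]cliffordE cmul_sumr [RHS]cliffordE.
by apply: eq_bigr => A _; rewrite -cmulZr cmul_blade csign0s symdiff0s scale1r.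
Qed.

Lemma cmul1r : right_id (blade set0) cmul.
Proof.
move=> a; rewrite {1}[a]cliffordE cmul_suml [RHS]cliffordE.
by apply: eq_bigr => A _; rewrite -cmulZl cmul_blade csigns0 symdiffs0 scale1r.
Qed.

Lemma cone_neq0 : blade set0 != 0.
Proof.
apply/eqP => /(congr1 (fun a => coord a set0)).
by rewrite coord_blade eqxx /coord mxE => /eqP; rewrite oner_eq0.
Qed.

HB.instance Definition _ := GRing.Zmodule_isNzRing.Build C
  cmulA cmul1l cmul1r cmulDl cmulDr cone_neq0.
HB.instance Definition _ := GRing.Lmodule_isLalgebra.Build R C cmulZl.
HB.instance Definition _ := GRing.Lalgebra_isAlgebra.Build R C cmulZr.

Definition is_cinv a : set C := [set b | b * a = 1 /\ a * b = 1]%classic.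
Definition cunit : pred C := fun a => `[< (is_cinv a !=set0)%classic >].
Definition cinv a : C := xget a (is_cinv a).

Lemma cinvP a : a \in cunit -> is_cinv a (cinv a).
Proof. by move=> /asboolP ua; exact: xgetPex. Qed.

Lemma cmulVr : {in cunit, left_inverse 1 cinv *%R}.
Proof. by move=> a /cinvP[]. Qed.

Lemma cmulrV : {in cunit, right_inverse 1 cinv *%R}.
Proof. by move=> a /cinvP[]. Qed.

Lemma cunitP a b : b * a = 1 /\ a * b = 1 -> cunit a.
Proof. by move=> ba; apply/asboolP; exists b. Qed.

Lemma cinv_out : {in [predC cunit], cinv =1 id}.
Proof.
move=> a /asboolPn na; rewrite /cinv; case: xgetP => // b _ ab.
by exfalso; apply: na; exists b.
Qed.

HB.instance Definition _ :=
  GRing.NzRing_hasMulInverse.Build C cmulVr cmulrV cunitP cinv_out.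

Definition gen (i : 'I_n) : C := blade [set i]%SET.

Lemma gen_sqr i : gen i * gen i = -1.
Proof.
rewrite /gen [LHS]cmul_blade.
have -> : symdiff [set i]%SET [set i]%SET = set0.
  by apply/finset.setP => k; rewrite in_symdiff addbb finset.inE.
rewrite /csign finset.big_set1 (big_pred1 i) ?scaleN1r // => j.
by rewrite finset.inE /=; have [->|] := eqVneq j i; rewrite ?leqnn.
Qed.

Lemma genC i j : i != j -> gen i * gen j = - (gen j * gen i).
Proof.
have csign11 (k l : 'I_n) :
  csign [set k]%SET [set l]%SET = if (l <= k)%N then -1 else 1.
  rewrite /csign finset.big_set1; case: ifP => lk.
    by rewrite (big_pred1 l) // => m; rewrite finset.inE /=;
       have [->|] := eqVneq m l; rewrite ?lk.
  by rewrite big_pred0 // => m; rewrite finset.inE; case: eqP => // ->.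
move=> ij; rewrite /gen [X in X = _]cmul_blade [X in - X]cmul_blade !csign11.
rewrite /symdiff [in RHS]finset.setUC; case: (ltngtP i j) => [_|_|/val_inj/eqP].
- by rewrite scaleN1r opprK scale1r.
- by rewrite scaleN1r scale1r.
- by rewrite (negPf ij).
Qed.

End CliffordRing.

Section SliceKernels.
Variables (R : realType) (n : nat).
Local Notation C := (clifford R n).
Local Notation V := 'rV[R]_n.+1.
Implicit Types (s x : V) (f : V -> C).

(* x = (x_0, ..., x_n) is read as the paravector x_0 + x_1 e_1 + ... + x_n e_n;
   with indices from 0, the coordinate x_i of e_i is x 0 (lift ord0 i). *)
Definition vpart x : C := \sum_(i < n) x 0 (lift ord0 i) *: gen R i.
Definition para x : C := (x 0 ord0)%:A + vpart x.
Definition paraconj x : C := (x 0 ord0)%:A - vpart x.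

(* The Euclidean norm; the library norm `|x| on row vectors is the sup norm. *)
Definition enorm x : R := Num.sqrt (\sum_(i < n.+1) x 0 i ^+ 2).

Definition Qc s x : C :=
  para s ^+ 2 - (2 * x 0 ord0) *: para s + (enorm x ^+ 2)%:A.

(* Meaningful for x outside the sphere [s], where Qc s x is invertible. *)
Definition SL s x : C := (para s - paraconj x) * (Qc s x)^-1.
Definition SR s x : C := (Qc s x)^-1 * (para s - paraconj x).

Definition partial (i : 'I_n.+1) f : V -> C := fun x => 'D_(delta_mx 0 i) f x.

Definition DL f : V -> C := fun x =>
  partial ord0 f x + \sum_(i < n) gen R i * partial (lift ord0 i) f x.
Definition DbarL f : V -> C := fun x =>
  partial ord0 f x - \sum_(i < n) gen R i * partial (lift ord0 i) f x.
Definition DR f : V -> C := fun x =>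
  partial ord0 f x + \sum_(i < n) partial (lift ord0 i) f x * gen R i.
Definition DbarR f : V -> C := fun x =>
  partial ord0 f x - \sum_(i < n) partial (lift ord0 i) f x * gen R i.
Definition Lap f : V -> C := fun x =>
  \sum_(i < n.+1) partial i (partial i f) x.

End SliceKernels.

Variant slice_op := opD | opLap | opLapD | opD2 | opDbar | opDbar2 | opLapDbar.

Definition actL (R : realType) (n : nat) (P : slice_op)
    (f : 'rV[R]_n.+1 -> clifford R n) : 'rV[R]_n.+1 -> clifford R n :=
  match P with
  | opD => DL f
  | opLap => Lap f
  | opLapD => Lap (DL f)
  | opD2 => DL (DL f)
  | opDbar => DbarL f
  | opDbar2 => DbarL (DbarL f)
  | opLapDbar => Lap (DbarL f)
  end.

(* A right action is read from left to right: f (Lap D) = (f Lap) D. *)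
Definition actR (R : realType) (n : nat) (P : slice_op)
    (f : 'rV[R]_n.+1 -> clifford R n) : 'rV[R]_n.+1 -> clifford R n :=
  match P with
  | opD => DR f
  | opLap => Lap f
  | opLapD => DR (Lap f)
  | opD2 => DR (DR f)
  | opDbar => DbarR f
  | opDbar2 => DbarR (DbarR f)
  | opLapDbar => DbarR (Lap f)
  end.

Definition kernelL (R : realType) (n : nat) (P : slice_op)
  (s x : 'rV[R]_n.+1) : clifford R n := actL P (SL s) x.
Definition kernelR (R : realType) (n : nat) (P : slice_op)
  (s x : 'rV[R]_n.+1) : clifford R n := actR P (SR s) x.

(* K = c * (u_m0 + u_(m0+1) + ...), the series being convergent. *)
Definition expansion (R : realType) (n : nat) (K : clifford R n) (c : R)
    (m0 : nat) (u : nat -> clifford R n) : Prop :=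
  cvgn (fun N => \sum_(m0 <= m < N) u m) /\
  K = c *: limn (fun N => \sum_(m0 <= m < N) u m).

(* Main.v *)
Require Import Defs.
From HB Require Import structures.
From mathcomp Require Import all_boot all_order all_algebra.
From mathcomp Require Import all_classical all_reals all_analysis.
From mathcomp Require Import zify ring lra.

Set Implicit Arguments.
Unset Strict Implicit.
Unset Printing Implicit Defensive.

Import Order.TTheory GRing.Theory Num.Theory.
Import numFieldNormedType.Exports.
Local Open Scope ring_scope.

(** Write xb for the conjugate of x and Q for [Qc s x], so that the left kernel
    is SL = (s - xb) Q^-1.  Left multiplications by x and xb commute with each
    other and with right multiplication by s, so expressions with x and xb kept
    on the left and s kept on the right multiply as in a commutative ring, in
    which Q = (s - x)(s - xb) and SL = 1 / (s - x).  In this reading every kernel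
    is a combination of fractions 1 / ((s - x)^p (s - xb)^r):
<<
      D       -4 / ((s-x)(s-xb))
      Lap     -8 / ((s-x)^2 (s-xb))
      Lap D   16 / ((s-x)^2 (s-xb)^2)
      D^2     -8 / ((s-x)(s-xb)^2)
      Db       2 / (s-x)^2 + 4 / ((s-x)(s-xb))
      Db^2     8 / (s-x)^3 + 16 / ((s-x)^2 (s-xb)) + 8 / ((s-x)(s-xb)^2)
      Lap Db -32 / ((s-x)^3 (s-xb)) - 32 / ((s-x)^2 (s-xb)^2)
>>
    and the theorem is the expansion of these fractions by the two negative
    binomial series.

    The fractions are obtained by differentiating the closed form of SL, so no
    series is ever differentiated.  This is easy because the gradient of Q has
    entries 2 (x_i - delta_i0 s), which lie in R[s] and hence commute with Q,
    and because the squares of the halved entries sum to Q: an operator applied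
    to a Q^-k, with a polynomial in x, is again of this kind ([dirac_term],
    [Lap_term]).

    The expansions ([hseries]) go by induction on p + r.  Dividing by s - y, for
    y = x or xb, means solving the Sylvester equation f s - y f = g; for partial
    sums this equation holds up to one boundary term ([sum_step]), its solution
    operator is explicit ([resolve_unique]), and the boundary term vanishes in
    the limit since multiplication by x on the left and by s^-1 on the right
    scale the Euclidean norm by |x| and 1 / |s| ([geometric_step]).

    The right kernels are the images of the left ones under reversal of
    products, an anti-automorphism that fixes paravectors and commutes with
    partial derivatives and limits ([derive_crev], [expansion_crev]).  Only the
    order of Lap relative to D and Db differs between the two sides, so these
    kernels are computed in both orders. *)

Local Notation coord := Defs.coord.

(** * Anti-automorphisms of the Clifford algebra *)
Section AntiAutomorphisms.
Variables (R : realType) (n : nat).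
Local Notation C := (clifford R n).
Implicit Types (a b c : C) (A B D : {set 'I_n}).

Lemma csign_sqr A B : csign R A B * csign R A B = 1.
Proof.
rewrite /csign -big_split /= big1 // => i _.
by rewrite -big_split /= big1 // => j _; rewrite mulrNN mulr1.
Qed.

Lemma coordD a b A : coord (a + b) A = coord a A + coord b A.
Proof. by rewrite /coord mxE. Qed.

Lemma coordN a A : coord (- a) A = - coord a A.
Proof. by rewrite /coord mxE. Qed.

Lemma coordZ (k : R) a A : coord (k *: a) A = k * coord a A.
Proof. by rewrite /coord mxE. Qed.

Definition coordE := (coordD, coordN, coordZ).

Lemma coord_sum (I : Type) (r : seq I) (P : pred I) (F : I -> C) A :
  coord (\sum_(i <- r | P i) F i) A = \sum_(i <- r | P i) coord (F i) A.
Proof.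
apply: (big_morph (fun a => coord a A)) => [a b|]; first exact: coordD.
by rewrite /coord mxE.
Qed.

Lemma coordP a b : (forall A, coord a A = coord b A) -> a = b.
Proof.
by move=> ab; rewrite [a]cliffordE [b]cliffordE; apply: eq_bigr => A _; rewrite ab.
Qed.

Lemma mulcE a b : a * b =
  \sum_A \sum_B (coord a A * coord b B * csign R A B) *: blade R (symdiff A B).
Proof. by []. Qed.

Definition twist (e : {set 'I_n} -> R) a : C :=
  \sum_A (e A * coord a A) *: blade R A.

(** The condition under which rescaling each e_A by the sign e A reverses
    products; the last factor is the sign by which e_A e_B and e_B e_A
    differ. *)
Definition reversing (e : {set 'I_n} -> R) := forall A B,
  e (symdiff A B) = e A * e B * (csign R A B * csign R B A).

Lemma coord_twist e a A : coord (twist e a) A = e A * coord a A.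
Proof.
rewrite coord_sum (bigD1 A) //= big1 => [|B /negPf BA].
  by rewrite coordZ coord_blade eqxx mulr1 addr0.
by rewrite coordZ coord_blade BA mulr0.
Qed.

Lemma twist_is_linear e : linear (twist e).
Proof.
move=> k a b; apply: coordP => A.
by rewrite coord_twist !(coordD, coordZ, coord_twist); ring.
Qed.

HB.instance Definition _ e := GRing.isLinear.Build R C C *:%R (twist e)
  (twist_is_linear e).

Lemma twist_blade e A : twist e (blade R A) = e A *: blade R A.
Proof.
apply: coordP => B; rewrite coord_twist coordZ coord_blade.
by case: eqP => [->|]; rewrite ?mulr0.
Qed.

Lemma symdiffC A B : symdiff A B = symdiff B A.
Proof. by rewrite /symdiff finset.setUC. Qed.

Lemma twistM e : reversing e ->
  forall a b, twist e (a * b) = twist e b * twist e a.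
Proof.
move=> re a b; rewrite [in RHS]mulcE exchange_big mulcE linear_sum.
apply: eq_bigr => A _ /=; rewrite linear_sum; apply: eq_bigr => B _ /=.
rewrite linearZ /= twist_blade scalerA symdiffC !coord_twist symdiffC re.
rewrite symdiffC; congr (_ *: _).
have := csign_sqr A B.
set u := csign R A B; set v := csign R B A => uu.
rewrite -[RHS]mul1r -uu; ring.
Qed.

Lemma twist_gen e i : twist e (gen R i) = e [set i]%SET *: gen R i.
Proof. exact: twist_blade. Qed.

End AntiAutomorphisms.

(** * Conjugation, reversal and the Euclidean norm *)
Section EuclideanNorm.
Variables (R : realType) (n : nat).
Local Notation C := (clifford R n).
Implicit Types (a b c : C) (A B D : {set 'I_n}).

(** Clifford conjugation: e_A goes to its inverse. *)
Definition cconj : C -> C := twist (fun A => csign R A A).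
(** Reversal: conjugation followed by the grade involution, so that each e_i
    is fixed. *)
Definition crev : C -> C :=
  twist (fun A => csign R A A * \prod_(i in A) (- 1)).

Lemma cconj_reversing : reversing (fun A : {set 'I_n} => csign R A A).
Proof. by move=> A B; rewrite csignsDl !csignsDr; ring. Qed.

Lemma crev_reversing :
  reversing (fun A : {set 'I_n} => csign R A A * \prod_(i in A) (- 1)).
Proof.
move=> A B; rewrite prod_symdiff => [|i]; last by rewrite mulrNN mulr1.
rewrite cconj_reversing; ring.
Qed.

HB.instance Definition _ := GRing.Linear.on cconj.
HB.instance Definition _ := GRing.Linear.on crev.

Lemma cconjM a b : cconj (a * b) = cconj b * cconj a.
Proof. exact/twistM/cconj_reversing. Qed.

Lemma crevM a b : crev (a * b) = crev b * crev a.
Proof. exact/twistM/crev_reversing. Qed.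

Lemma csign_gen (i : 'I_n) : csign R [set i]%SET [set i]%SET = - 1.
Proof.
rewrite /csign finset.big_set1 (big_pred1 i) // => j.
by rewrite finset.inE /=; have [->|] := eqVneq j i; rewrite ?leqnn.
Qed.

Lemma cconj_gen i : cconj (gen R i) = - gen R i.
Proof. by rewrite /cconj twist_gen csign_gen scaleN1r. Qed.

Lemma crev_gen i : crev (gen R i) = gen R i.
Proof.
by rewrite /crev twist_gen csign_gen finset.big_set1 mulrNN mulr1 scale1r.
Qed.

Lemma crev1 : crev 1 = 1.
Proof.
rewrite /crev (twist_blade _ (@finset.set0 'I_n)) csign0s finset.big_set0.
by rewrite mulr1 scale1r.
Qed.

Lemma cconj1 : cconj 1 = 1.
Proof. by rewrite /cconj (twist_blade _ (@finset.set0 'I_n)) csign0s scale1r. Qed.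

Lemma crevK : involutive crev.
Proof.
move=> a; apply: coordP => A; rewrite !coord_twist mulrA.
rewrite [X in X * _](_ : _ = 1) ?mul1r // mulrACA csign_sqr mul1r.
by rewrite -big_split big1 //= => i _; rewrite mulrNN mulr1.
Qed.

Definition sqnorm a : R := \sum_A coord a A ^+ 2.

Lemma coord0M a b :
  coord (a * b) (@finset.set0 'I_n) = \sum_A coord a A * coord b A * csign R A A.
Proof.
rewrite mulcE coord_sum; apply: eq_bigr => A _.
rewrite coord_sum (bigD1 A) //= big1 => [|B /negPf BA].
  rewrite coordZ coord_blade addr0 [_ == _](_ : _ = true) ?mulr1 //.
  by apply/eqP/finset.setP => i; rewrite in_symdiff addbb finset.inE.
rewrite coordZ coord_blade [_ == _](_ : _ = false) ?mulr0 //.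
apply/negbTE/negP => /eqP AB; move: BA; rewrite (_ : B = A) ?eqxx //.
apply/finset.setP => i; move: AB => /finset.setP/(_ i).
by rewrite in_symdiff finset.inE; case: (i \in A); case: (i \in B).
Qed.

(** The inverse of e_A is [csign A A] e_A, so only the diagonal products reach
    the scalar part, each with sign 1.  Together with [sqnormEr] this makes
    one-sided multiplication by a paravector scale the norm. *)
Lemma sqnormEl a : sqnorm a = coord (cconj a * a) (@finset.set0 'I_n).
Proof.
rewrite coord0M; apply: eq_bigr => A _; rewrite coord_twist.
by rewrite -[LHS]mul1r -(@csign_sqr R n A A); ring.
Qed.

Lemma sqnormEr a : sqnorm a = coord (a * cconj a) (@finset.set0 'I_n).
Proof.
rewrite coord0M; apply: eq_bigr => A _; rewrite coord_twist.
by rewrite -[LHS]mul1r -(@csign_sqr R n A A); ring.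
Qed.

Lemma sqnorm_ge0 a : 0 <= sqnorm a.
Proof. by apply: sumr_ge0 => A _; exact: sqr_ge0. Qed.

Lemma coord_sqnorm a A : coord a A ^+ 2 <= sqnorm a.
Proof.
rewrite /sqnorm (bigD1 A) //= lerDl; apply: sumr_ge0 => B _; exact: sqr_ge0.
Qed.

(** A substitute for the triangle inequality that needs no square roots; the
    factor 1 + d can be taken as close to 1 as a contraction rate demands. *)
Lemma sqnorm_addr (d : R) a b : 0 < d ->
  sqnorm (a + b) <= (1 + d) * sqnorm a + (1 + d^-1) * sqnorm b.
Proof.
move=> d0; rewrite /sqnorm !mulr_sumr -big_split /=; apply: ler_sum => A _.
rewrite coordD -subr_ge0.
rewrite (_ : _ - _ = d^-1 * (d * coord a A - coord b A) ^+ 2); last first.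
  by field; rewrite gt_eqF.
by rewrite mulr_ge0 ?sqr_ge0 // invr_ge0 ltW.
Qed.

End EuclideanNorm.

(** * Paravectors and the polynomial Qc *)
Section Paravectors.
Variables (R : realType) (n : nat).
Local Notation C := (clifford R n).
Local Notation V := 'rV[R]_n.+1.
Implicit Types (a b c : C) (s x v w : V).

Definition distrE := (mulrDl, mulrDr, mulrN, mulNr, mulr1, mul1r).

Lemma vpart_is_linear : linear (@vpart R n).
Proof.
move=> k v w; rewrite /vpart scaler_sumr -big_split /=.
by apply: eq_bigr => i _; rewrite !mxE scalerDl scalerA.
Qed.

HB.instance Definition _ := GRing.isLinear.Build R V C *:%R (@vpart R n)
  vpart_is_linear.

Lemma para_is_linear : linear (@para R n).
Proof.
move=> k v w; rewrite /para linearP !mxE /= scalerDr scalerDl scalerA.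
by rewrite addrACA.
Qed.

Lemma paraconj_is_linear : linear (@paraconj R n).
Proof.
move=> k v w; rewrite /paraconj linearP !mxE /= scalerBr scalerDl scalerA.
by rewrite opprD addrACA.
Qed.

HB.instance Definition _ := GRing.isLinear.Build R V C *:%R (@para R n)
  para_is_linear.
HB.instance Definition _ := GRing.isLinear.Build R V C *:%R (@paraconj R n)
  paraconj_is_linear.

Lemma paraconjE x : paraconj x = (2 * x 0 ord0)%:A - para x.
Proof. by apply: coordP => A; rewrite /para /paraconj !coordE; ring. Qed.

Lemma para_comm x : para x * paraconj x = paraconj x * para x.
Proof.
by rewrite paraconjE mulrBl mulrBr; move: (para x) => p; rewrite mulr_algl mulr_algr.
Qed.

Definition dotv v w : R := \sum_i v 0 i * w 0 i.

Lemma enorm_sqr x : enorm x ^+ 2 = dotv x x.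
Proof. by rewrite sqr_sqrtr // sumr_ge0 // => i _; exact: sqr_ge0. Qed.

Lemma vpart_polar v w : vpart v * vpart w + vpart w * vpart v =
  (- 2 * \sum_(i < n) v 0 (lift ord0 i) * w 0 (lift ord0 i))%:A.
Proof.
have E (y z : V) : vpart y * vpart z = \sum_(i < n) \sum_(j < n)
    (y 0 (lift ord0 i) * z 0 (lift ord0 j)) *: (gen R i * gen R j).
  rewrite /vpart mulr_suml; apply: eq_bigr => i _.
  rewrite mulr_sumr; apply: eq_bigr => j _.
  by rewrite -scalerAl -scalerAr scalerA.
rewrite !E [X in _ + X]exchange_big -big_split mulr_sumr scaler_suml /=.
apply: eq_bigr => i _; rewrite -big_split (bigD1 i) //= big1 => [|j ji].
  rewrite gen_sqr addr0 -scalerDl; apply: coordP => A; rewrite !coordE; ring.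
rewrite genC ?(eq_sym i) //; apply: coordP => A; rewrite !coordE.
by rewrite [RHS]mxE; ring.
Qed.

(** Polarization of x xb = |x|^2; it turns the derivative of |x|^2 into a
    scalar. *)
Lemma para_polar v w :
  para v * paraconj w + para w * paraconj v = (2 * dotv v w)%:A.
Proof.
have := vpart_polar v w; rewrite /para /paraconj /dotv !big_ord_recl !distrE.
set S := \sum_(i < n) _.
rewrite !mulr_algl !mulr_algr => VW; apply: coordP => A.
have {VW} := congr1 (fun a => coord a A) VW; rewrite !coordE.
move: (coord (vpart v * _) A) (coord (vpart w * _) A) => p q pq.
rewrite -[p](addrK q) pq; ring.
Qed.

Lemma para_mul_conj x : para x * paraconj x = (enorm x ^+ 2)%:A.
Proof.
apply: (@scalerI _ _ (2 : R)); rewrite ?pnatr_eq0 //.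
by rewrite scaler_nat mulr2n para_polar scalerA enorm_sqr.
Qed.

Lemma conj_mul_para x : paraconj x * para x = (enorm x ^+ 2)%:A.
Proof. by rewrite -para_comm para_mul_conj. Qed.

Lemma para_sum (h : {linear V -> C}) x :
  h x = \sum_i x 0 i *: h (delta_mx 0 i).
Proof.
by rewrite {1}[x]row_sum_delta linear_sum; apply: eq_bigr => i _; rewrite linearZ.
Qed.

Lemma vpart_unit0 : vpart (delta_mx 0 ord0 : V) = 0.
Proof. by rewrite /vpart big1 // => i _; rewrite mxE /= scale0r. Qed.

Lemma vpart_unitS i : vpart (delta_mx 0 (lift ord0 i) : V) = gen R i.
Proof.
rewrite /vpart (bigD1 i) //= mxE !eqxx scale1r big1 ?addr0 // => j ji.
by rewrite mxE (inj_eq lift_inj) (negPf ji) andbF scale0r.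
Qed.

Lemma para_unit0 : para (delta_mx 0 ord0 : V) = 1.
Proof. by rewrite /para vpart_unit0 mxE !eqxx scale1r addr0. Qed.

Lemma para_unitS i : para (delta_mx 0 (lift ord0 i) : V) = gen R i.
Proof. by rewrite /para vpart_unitS mxE /= scale0r add0r. Qed.

Lemma paraconj_unit0 : paraconj (delta_mx 0 ord0 : V) = 1.
Proof. by rewrite /paraconj vpart_unit0 mxE !eqxx scale1r subr0. Qed.

Lemma paraconj_unitS i : paraconj (delta_mx 0 (lift ord0 i) : V) = - gen R i.
Proof. by rewrite /paraconj vpart_unitS mxE /= scale0r sub0r. Qed.

Lemma cconj_para x : cconj (para x) = paraconj x.
Proof.
rewrite /para linearD linearZ /= cconj1 linear_sum /paraconj /vpart.
congr (_ + _); rewrite -sumrN; apply: eq_bigr => i _.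
by rewrite linearZ /= cconj_gen scalerN.
Qed.

Lemma crev_para x : crev (para x) = para x.
Proof.
rewrite /para linearD linearZ /= crev1 linear_sum.
by congr (_ + _); apply: eq_bigr => i _; rewrite linearZ /= crev_gen.
Qed.

Lemma crev_paraconj x : crev (paraconj x) = paraconj x.
Proof. by rewrite paraconjE linearB linearZ /= crev1 crev_para. Qed.

Lemma DLE (f : V -> C) x :
  DL f x = \sum_i para (delta_mx 0 i : V) * partial i f x.
Proof.
rewrite big_ord_recl para_unit0 mul1r; congr (_ + _).
by apply: eq_bigr => i _; rewrite para_unitS.
Qed.

Lemma DbarLE (f : V -> C) x :
  DbarL f x = \sum_i paraconj (delta_mx 0 i : V) * partial i f x.
Proof.
rewrite /DbarL big_ord_recl paraconj_unit0 mul1r -sumrN; congr (_ + _).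
by apply: eq_bigr => i _; rewrite paraconj_unitS mulNr.
Qed.

Lemma sqnorm_mull x a : sqnorm (para x * a) = enorm x ^+ 2 * sqnorm a.
Proof.
rewrite !sqnormEl cconjM cconj_para -mulrA [paraconj x * _]mulrA.
by rewrite conj_mul_para mulr_algl -scalerAr coordZ.
Qed.

Lemma sqnorm_mulr s a : sqnorm (a * para s) = enorm s ^+ 2 * sqnorm a.
Proof.
rewrite !sqnormEr cconjM cconj_para -mulrA [para s * _]mulrA.
by rewrite para_mul_conj mulr_algl -scalerAr coordZ.
Qed.

Lemma para_unit s : enorm s != 0 -> para s \is a GRing.unit.
Proof.
move=> s0; apply/unitrP; exists ((enorm s ^+ 2)^-1 *: paraconj s).
by rewrite -scalerAl -scalerAr conj_mul_para para_mul_conj scalerA mulVf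
  ?expf_neq0 // scale1r.
Qed.


Lemma QcE s x : Qc s x =
  para s ^+ 2 - (para x + paraconj x) * para s + para x * paraconj x.
Proof.
rewrite para_mul_conj paraconjE [para x + _]addrC addrNK mulr_algl.
by [].
Qed.

Lemma para_sqr s : para s ^+ 2 = (2 * s 0 ord0) *: para s - (enorm s ^+ 2)%:A.
Proof.
by rewrite -para_mul_conj paraconjE mulrBr mulr_algr opprB addrCA subrr addr0.
Qed.

Lemma Qc_affine s x : Qc s x = (2 * (s 0 ord0 - x 0 ord0)) *: para s
  + (enorm x ^+ 2 - enorm s ^+ 2)%:A.
Proof. by rewrite /Qc para_sqr; apply: coordP => A; rewrite !coordE; ring. Qed.

(** Qc is affine in s because s^2 = 2 s_0 s - |s|^2, so conjugation merely
    replaces s by its conjugate. *)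
Lemma cconj_Qc s x : cconj (Qc s x) = (2 * (s 0 ord0 - x 0 ord0)) *: paraconj s
  + (enorm x ^+ 2 - enorm s ^+ 2)%:A.
Proof. by rewrite Qc_affine linearD !linearZ /= cconj1 cconj_para. Qed.

Lemma coord01 : coord (1 : C) (@finset.set0 'I_n) = 1.
Proof. by rewrite (@coord_blade R n finset.set0 finset.set0) eqxx. Qed.

(** |alpha s + beta|^2 for the affine form alpha s + beta of Qc, with the square
    in beta completed. *)
Definition Qc_sqnorm s x : R :=
  (enorm x ^+ 2 - enorm s ^+ 2 + 2 * (s 0 ord0 - x 0 ord0) * s 0 ord0) ^+ 2
  + (2 * (s 0 ord0 - x 0 ord0)) ^+ 2 * (enorm s ^+ 2 - s 0 ord0 ^+ 2).

Lemma Qc_cconjE s x : Qc s x * cconj (Qc s x) = (Qc_sqnorm s x)%:A.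
Proof.
rewrite cconj_Qc Qc_affine.
set N := Qc_sqnorm s x.
have : N = Qc_sqnorm s x by []; clearbody N; rewrite /Qc_sqnorm.
set al := 2 * (s 0 ord0 - x 0 ord0).
set be := enorm x ^+ 2 - enorm s ^+ 2; clearbody al be.
move: (para_mul_conj s); rewrite paraconjE.
move: (enorm s ^+ 2) (para s) => t p pp NE.
rewrite mulrDl !mulrDr -!scalerAl -!scalerAr ?mulr1 ?mul1r pp.
by apply: coordP => A; rewrite !coordE NE; ring.
Qed.

Lemma sqnorm_Qc s x : sqnorm (Qc s x) = Qc_sqnorm s x.
Proof. by rewrite sqnormEr Qc_cconjE coordZ coord01 mulr1. Qed.

Lemma Qc_mul_cconj s x : Qc s x * cconj (Qc s x) = (sqnorm (Qc s x))%:A.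
Proof. by rewrite sqnorm_Qc Qc_cconjE. Qed.

Lemma cconj_mul_Qc s x : cconj (Qc s x) * Qc s x = (sqnorm (Qc s x))%:A.
Proof.
rewrite -Qc_mul_cconj cconj_Qc Qc_affine.
move: (para_comm s); move: (para s) (paraconj s) => p pb ppb.
rewrite !mulrDl !mulrDr -!scalerAl -!scalerAr ?mulr1 ?mul1r ppb.
by apply: coordP => A; rewrite !coordE; ring.
Qed.

(** Qc vanishes only where x lies on the sphere of s, hence |x| = |s|: both
    squares in [Qc_sqnorm] would vanish, and either way of killing the second
    one contradicts |x| < |s|. *)
Lemma Qc_neq0 s x : enorm x < enorm s -> sqnorm (Qc s x) != 0.
Proof.
move=> xs; have x0 : 0 <= enorm x := sqrtr_ge0 _.
have : enorm x ^+ 2 < enorm s ^+ 2.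
  by rewrite ltr_sqr // nnegrE (le_trans _ (ltW xs)).
have ge0 (v : V) : v 0 ord0 ^+ 2 <= enorm v ^+ 2.
  rewrite enorm_sqr /dotv big_ord_recl -expr2 lerDl sumr_ge0 // => i _.
  by rewrite -expr2 sqr_ge0.
rewrite sqnorm_Qc /Qc_sqnorm; move: (ge0 s) (ge0 x).
move: (enorm x ^+ 2) (enorm s ^+ 2) (s 0 ord0) (x 0 ord0) => r t u v ut vr rt.
apply/negP; rewrite paddr_eq0 ?sqr_ge0 //; last by rewrite mulr_ge0 ?sqr_ge0 ?subr_ge0.
move=> /andP[]; rewrite sqrf_eq0 => /eqP e1.
rewrite mulf_eq0 sqrf_eq0 => /orP[]/eqP e2.
  by move: e1; rewrite e2 mul0r; lra.
have h3 : 0 <= (u - v) ^+ 2 by exact: sqr_ge0.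
have : (u - v) ^+ 2 = 0 by nra.
move/eqP; rewrite sqrf_eq0 => /eqP uv.
by move: e1; rewrite uv mulr0 mul0r; lra.
Qed.

Lemma Qc_unit s x : enorm x < enorm s -> Qc s x \is a GRing.unit.
Proof.
move=> xs; apply/unitrP; exists ((sqnorm (Qc s x))^-1 *: cconj (Qc s x)).
by rewrite -scalerAl -scalerAr cconj_mul_Qc Qc_mul_cconj scalerA mulVf
  ?Qc_neq0 // scale1r.
Qed.

(** An explicit inverse, from which the continuity of the inverse in x can be
    read off. *)
Lemma Qc_inv s x : enorm x < enorm s ->
  (Qc s x)^-1 = (sqnorm (Qc s x))^-1 *: cconj (Qc s x).
Proof.
move=> xs; apply: (mulrI (Qc_unit xs)); rewrite divrr ?Qc_unit //.
by rewrite -scalerAr Qc_mul_cconj scalerA mulVf ?Qc_neq0 // scale1r.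
Qed.

End Paravectors.

(** * Division by s - y *)
Section Sylvester.
Variables (R : realType) (n : nat) (s : 'rV[R]_n.+1).
Local Notation C := (clifford R n).
Implicit Types (y f g c : C).

(** Multiplication of g by s - y when y acts on the left and s on the
    right. *)
Definition sylvester y g : C := g * para s - y * g.

Lemma sylvesterD y f g : sylvester y (f + g) = sylvester y f + sylvester y g.
Proof.
rewrite /sylvester; move: (para s) => p.
by rewrite mulrDl mulrDr opprD addrACA.
Qed.

Lemma sylvesterZ y (k : R) g : sylvester y (k *: g) = k *: sylvester y g.
Proof. by rewrite /sylvester -scalerAl -scalerAr scalerBr. Qed.

Lemma sylvesterM y g c : GRing.comm c (para s) ->
  sylvester y (g * c) = sylvester y g * c.
Proof.
rewrite /sylvester => cs; move: (para s) cs => p cs.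
by rewrite mulrBl -!mulrA cs.
Qed.

End Sylvester.

(** * Limits and directional derivatives of Clifford-valued functions *)
Section CliffordTopology.
Local Open Scope classical_set_scope.
Local Open Scope ring_scope.
Variables (R : realType) (n : nat).
Local Notation C := (clifford R n).
Implicit Types (a b c : C).

Lemma coord_cts A : continuous (fun a => coord a A : R).
Proof. exact: (@coord_continuous R 1 #|{set 'I_n}| 0 (enum_rank A)). Qed.

Lemma cvg_coord (T : Type) (F : set_system T) {FF : Filter F} (f : T -> C) a A :
  f @ F --> a -> (coord (f t) A @[t --> F]) --> (coord a A : R).
Proof. by move=> fa; exact: (cvg_comp f (fun b : C => coord b A : R) fa (@coord_cts A a)). Qed.

Lemma cvgc_sum (T I : Type) (F : set_system T) {FF : Filter F} (r : seq I)
    (f : I -> T -> C) (a : I -> C) :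
  (forall i, f i @ F --> a i) ->
  (\sum_(i <- r) f i t @[t --> F]) --> \sum_(i <- r) a i.
Proof.
move=> fa; elim: r => [|i r IH].
  rewrite big_nil; under eq_fun do rewrite big_nil.
  exact: cvg_cst.
rewrite big_cons; under eq_fun do rewrite big_cons.
exact: cvgD (fa i) IH.
Qed.

Lemma cvg_clifford (T : Type) (F : set_system T) {FF : Filter F}
    (f : T -> C) a :
  (forall A, (coord (f t) A @[t --> F]) --> (coord a A : R)) -> f @ F --> a.
Proof.
move=> fa; rewrite [a]cliffordE.
rewrite (_ : f = fun t => \sum_A coord (f t) A *: blade R A); last first.
  by apply/funext => t; exact: cliffordE.
by apply: cvgc_sum => A; exact: cvgZr_tmp (fa A).
Qed.

Lemma cvgMc (T : Type) (F : set_system T) {FF : Filter F} (f g : T -> C) a b :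
  f @ F --> a -> g @ F --> b -> (f t * g t @[t --> F]) --> a * b.
Proof.
move=> fa gb; rewrite mulcE.
under eq_fun do rewrite mulcE.
apply: cvgc_sum => A; apply: cvgc_sum => B.
by apply: cvgZr_tmp; apply: cvgMr_tmp; apply: cvgM; exact: cvg_coord.
Qed.

Lemma cvg_twist (T : Type) (F : set_system T) {FF : Filter F} e (f : T -> C) a :
  f @ F --> a -> twist e (f t) @[t --> F] --> twist e a.
Proof.
move=> fa; apply: cvgc_sum => A.
by apply: cvgZr_tmp; apply: cvgMl_tmp; exact: cvg_coord.
Qed.

Variable V : normedModType R.
Implicit Types (f g : V -> C) (x v : V).

Lemma is_derive_quotientP (W : normedModType R) (f : V -> W) x v df :
  is_derive x v f df <->
  h^-1 *: (f (h *: v + x) - f x) @[h --> (0 : R)^'] --> df.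
Proof.
split=> [[fx <-] //|fdf]; apply: DeriveDef; first by apply/cvg_ex; exists df.
exact: cvg_lim fdf.
Qed.

Lemma is_derive_continuous_line f x v df : is_derive x v f df ->
  f (h *: v + x) @[h --> (0 : R)^'] --> f x.
Proof.
move=> /is_derive_quotientP fdf.
have /(cvgD (cvg_cst (f x))) : h *: (h^-1 *: (f (h *: v + x) - f x))
    @[h --> (0 : R)^'] --> (0 : R) *: df.
  by apply: cvgZ fdf; exact: nbhs_dnbhs.
rewrite scale0r addr0; apply: cvg_trans; apply: near_eq_cvg.
near=> h; have h0 : h != 0 by near: h; exact: nbhs_dnbhs_neq.
by rewrite fctE /= scalerA divff // scale1r addrC subrK.
Unshelve. all: by end_near. Qed.

(** The Leibniz rule, by splitting the difference quotient of a product; the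
    order of the factors is kept. *)
Lemma is_derive_cmul f g x v df dg : is_derive x v f df -> is_derive x v g dg ->
  is_derive x v (fun y => f y * g y) (f x * dg + df * g x).
Proof.
move=> fdf gdg; have gc := is_derive_continuous_line gdg.
move: fdf gdg => /is_derive_quotientP fdf /is_derive_quotientP gdg.
apply/is_derive_quotientP.
have fgl : f x * (h^-1 *: (g (h *: v + x) - g x)) +
    h^-1 *: (f (h *: v + x) - f x) * g (h *: v + x) @[h --> (0 : R)^']
    --> f x * dg + df * g x.
  by apply: cvgD (cvgMc _ gdg) (cvgMc fdf gc); exact: cvg_cst.
apply: cvg_trans fgl; apply: near_eq_cvg; near=> h.
rewrite /= -scalerAl -scalerAr -scalerDr mulrBr mulrBl.
by congr (_ *: _); rewrite addrC addrA subrK.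
Unshelve. all: by end_near. Qed.

Lemma near_line (P : V -> Prop) x v : (\near x, P x) ->
  \forall h \near (0 : R)^', P (h *: v + x).
Proof.
move=> Px; apply: nbhs_dnbhs; have c : h *: v + x @[h --> (0 : R)] --> x.
  rewrite -[X in _ --> X]add0r -(scale0r v).
  by apply: cvgD; [apply: cvgZr_tmp; exact: cvg_id|exact: cvg_cst].
exact: c _ Px.
Qed.

(** From b^-1 - a^-1 = - b^-1 (b - a) a^-1; continuity of the inverse along the
    line is a hypothesis and is supplied from an explicit formula. *)
Lemma is_derive_inv f x v df : is_derive x v f df ->
  (\near x, f x \is a GRing.unit) ->
  (f (h *: v + x))^-1 @[h --> (0 : R)^'] --> (f x)^-1 ->
  is_derive x v (fun y => (f y)^-1) (- ((f x)^-1 * df * (f x)^-1)).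
Proof.
move=> /is_derive_quotientP fdf ux fc; apply/is_derive_quotientP.
have fl : - ((f (h *: v + x))^-1 * (h^-1 *: (f (h *: v + x) - f x)) * (f x)^-1)
    @[h --> (0 : R)^'] --> - ((f x)^-1 * df * (f x)^-1).
  by apply: cvgN; apply: cvgMc (cvgMc fc fdf) _; exact: cvg_cst.
apply: cvg_trans fl; apply: near_eq_cvg.
have ux0 := nbhs_singleton ux.
have {}ux := near_line v ux.
near=> h; have uh : f (h *: v + x) \is a GRing.unit by near: h.
rewrite /= -!scalerAr -scalerAl -scalerN mulrBr mulrBl mulVr // mul1r.
by rewrite -mulrA divrr // mulr1 opprB.
Unshelve. all: by end_near. Qed.

(** Reversal is a linear homeomorphism.  No differentiability is assumed: where
    the difference quotient diverges, both sides are the default limit 0, which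
    reversal fixes. *)
Lemma derive_crev f x v : 'D_v (@crev R n \o f) x = crev ('D_v f x).
Proof.
rewrite /derive.
set g := fun h : R => h^-1 *: ((f \o shift x) (h *: v) - f x).
rewrite (_ : (fun h => _) = @crev R n \o g); last first.
  by apply/funext => h /=; rewrite -linearB -linearZ.
have [cg|dg] := pselect (cvg (g @ 0^')).
  apply: cvg_lim => //; exact: cvg_twist.
have dg' : ~ cvg ((@crev R n \o g) @ 0^').
  move=> /(cvg_twist (e := fun A => csign R A A * \prod_(i in A) (- 1))) cg; apply: dg.
  apply/cvg_ex; exists (crev (lim ((@crev R n \o g) @ 0^'))).
  have crg : (fun h => crev (crev (g h))) = g by apply/funext => h; rewrite crevK.
  by rewrite -[X in X @ _]crg; exact: cg.
rewrite (dvgP dg) (dvgP dg').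
have -> : (point : C) = 0.
  by apply/rowP => i; rewrite !mxE.
by rewrite linear0.
Qed.

End CliffordTopology.

(** * Derivatives of a polynomial times powers of the inverse of Qc *)
Section KernelCalculus.
Local Open Scope classical_set_scope.
Local Open Scope ring_scope.
Variables (R : realType) (n : nat).
Local Notation C := (clifford R n).
Local Notation V := 'rV[R]_n.+1.
Variable s : V.
Implicit Types (a b c : C) (x v w : V).

Local Notation e i := (delta_mx 0 i : V).
Local Notation inball := (fun x : V => enorm x < enorm s).

Lemma enorm_continuous : continuous (@enorm R n : V -> R).
Proof.
move=> x; apply: (@continuous_comp _ _ _ (fun y : V => \sum_i y 0 i ^+ 2)
  (@Num.sqrt R)); last exact: sqrt_continuous.
apply: (@cvg_big _ _ _ _ _ _ _ _ _ (fun i (y : V) => y 0 i ^+ 2)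
  (fun i => x 0 i ^+ 2) (nbhs_filter x)) => [|i _].
  by move=> y; exact: add_continuous.
by apply: (@cvgM R V (nbhs x) _ (fun y : V => y 0 i) (fun y : V => y 0 i));
  exact: coord_continuous.
Qed.

Lemma near_inball x : inball x -> \near x, inball x.
Proof.
move=> xs; have := @enorm_continuous x.
by move/cvgr_lt => /(_ _ xs).
Qed.

Lemma is_derive_affine (f : V -> C) x v d :
  (forall h, f (h *: v + x) = f x + h *: d) -> is_derive x v f d.
Proof.
move=> fd; apply/is_derive_quotientP.
have dd : d @[h --> (0 : R)^'] --> d by exact: cvg_cst.
apply: cvg_trans dd; apply: near_eq_cvg; near=> h.
have h0 : h != 0 by near: h; exact: nbhs_dnbhs_neq.
by rewrite fd addrC addKr scalerA mulVf // scale1r.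
Unshelve. all: by end_near. Qed.

Lemma is_derive_linear (f : {linear V -> C}) x v : is_derive x v f (f v).
Proof. by apply: is_derive_affine => h; rewrite linearP addrC. Qed.

(** Half the derivative of Qc in direction v; it lies in R[s], hence commutes
    with Qc. *)
Definition half_dQc v x : C := (dotv v x)%:A - v 0 ord0 *: para s.

Lemma dotvD v x y : dotv v (x + y) = dotv v x + dotv v y.
Proof.
by rewrite /dotv -big_split; apply: eq_bigr => i _; rewrite mxE mulrDr.
Qed.

Lemma dotvZ v (k : R) x : dotv v (k *: x) = k * dotv v x.
Proof.
by rewrite /dotv mulr_sumr; apply: eq_bigr => i _; rewrite mxE mulrCA.
Qed.

Lemma dotvC v w : dotv v w = dotv w v.
Proof. by apply: eq_bigr => i _; rewrite mulrC. Qed.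

Lemma is_derive_half_dQc v w x : is_derive x w (half_dQc v) (dotv v w)%:A.
Proof.
apply: is_derive_affine => h; rewrite /half_dQc dotvD dotvZ.
by apply: coordP => A; rewrite !coordE; ring.
Qed.

Lemma is_derive_Qc x v : is_derive x v (Qc s) (2 *: half_dQc v x).
Proof.
have -> : Qc s = cst (para s ^+ 2) - (fun y => (@para R n + @paraconj R n) y
    * para s) + (fun y => para y * paraconj y) by apply/funext => y; exact: QcE.
have dp := is_derive_linear (@para R n) x v.
have dc := is_derive_linear (@paraconj R n) x v.
have dQ := is_deriveD (is_deriveB (is_derive_cst (para s ^+ 2) x v)
  (is_derive_cmul (is_deriveD dp dc) (is_derive_cst (para s) x v)))
  (is_derive_cmul dp dc).
apply: is_derive_eq.
rewrite /cst mulr0 !add0r para_polar.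
have -> : (@para R n) v + (@paraconj R n) v = (2 * v 0 ord0)%:A.
  by rewrite paraconjE addrC subrK.
by rewrite dotvC /half_dQc; apply: coordP => A; rewrite mulr_algl !coordE; ring.
Qed.

Local Notation q x := (Qc s x)^-1.

Lemma sqnorm_cvg (T : Type) (F : set_system T) {FF : Filter F} (f : T -> C) a :
  f @ F --> a -> sqnorm (f t) @[t --> F] --> sqnorm a.
Proof.
move=> fa; rewrite sqnormEl; under eq_fun do rewrite sqnormEl.
by apply: cvg_coord; apply: cvgMc => //; exact: cvg_twist.
Qed.

Lemma Qc_inv_line x v : inball x -> q (h *: v + x) @[h --> (0 : R)^'] --> q x.
Proof.
move=> xs; rewrite Qc_inv //.
have Qcv := is_derive_continuous_line (is_derive_Qc x v).
have : (sqnorm (Qc s (h *: v + x)))^-1 *: cconj (Qc s (h *: v + x))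
    @[h --> (0 : R)^'] --> (sqnorm (Qc s x))^-1 *: cconj (Qc s x).
  apply: cvgZ (cvg_twist Qcv); apply: cvgV (sqnorm_cvg Qcv); exact: Qc_neq0.
apply: cvg_trans; apply: near_eq_cvg.
by near=> h; rewrite Qc_inv //; near: h; exact: (near_line v (near_inball xs)).
Unshelve. all: by end_near. Qed.

Lemma Qc_comm x : GRing.comm (Qc s x) (para s).
Proof.
rewrite Qc_affine /GRing.comm.
move: (para s) (2 * (s 0 ord0 - x 0 ord0)) (_ - _ : R) => p k l.
by rewrite mulrDl mulrDr -!scalerAl -!scalerAr mulr1 mul1r.
Qed.

Lemma Qc_inv_comm x : GRing.comm (q x) (para s).
Proof. by apply/commr_sym/commrV/commr_sym/Qc_comm. Qed.

Lemma half_dQc_comm v x : GRing.comm (q x) (half_dQc v x).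
Proof.
have := Qc_inv_comm x; rewrite /GRing.comm /half_dQc; move: (para s) (q x) => p c pc.
by rewrite mulrBl mulrBr -!scalerAl -!scalerAr mulr1 mul1r pc.
Qed.

Lemma is_derive_Qc_invX x v k : inball x ->
  is_derive x v (fun y => q y ^+ k) ((- (2 * k)%:R) *: (half_dQc v x * q x ^+ k.+1)).
Proof.
move=> xs; have w := half_dQc_comm v x.
have dq := is_derive_inv (is_derive_Qc x v) _ (Qc_inv_line v xs).
have {}dq : is_derive x v (fun y => q y) (- 2 *: (half_dQc v x * q x ^+ 2)).
  apply: is_derive_eq (dq _) _.
    by apply: filterS (near_inball xs) => y; exact: Qc_unit.
  by rewrite -scalerAr -scalerAl w scaleNr mulrA.
elim: k => [|k IH].
  by rewrite muln0 oppr0 scale0r; exact: is_derive_cst.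
have -> : (fun y => q y ^+ k.+1) = (fun y => q y * q y ^+ k).
  by apply/funext => y; rewrite exprS.
apply: is_derive_eq (is_derive_cmul dq IH) _.
rewrite -scalerAr -scalerAl mulrA w -!mulrA -!exprS -scalerDl.
by congr (_ *: _); rewrite mulnS natrD; ring.
Qed.

Lemma is_derive_term (a : V -> C) da x v k : inball x -> is_derive x v a da ->
  is_derive x v (fun y => a y * q y ^+ k)
    (da * q x ^+ k - (2 * k)%:R *: (a x * half_dQc v x * q x ^+ k.+1)).
Proof.
move=> xs dax; apply: is_derive_eq (is_derive_cmul dax (is_derive_Qc_invX v k xs)) _.
by rewrite -scalerAr scaleNr addrC mulrA.
Qed.

Lemma half_dQc_unit i x :
  half_dQc (e i) x = (x 0 i)%:A - (i == ord0)%:R *: para s.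
Proof.
rewrite /half_dQc mxE eqxx eq_sym /=; congr (_%:A - _).
rewrite /dotv (bigD1 i) //= mxE !eqxx mul1r big1 ?addr0 // => j /negPf ji.
by rewrite mxE ji andbF mul0r.
Qed.

(** In direction e_i the half derivative is x_i - delta_i0 s. *)
Lemma sum_half_dQc (F : 'I_n.+1 -> C) x :
  \sum_i F i * half_dQc (e i) x = \sum_i x 0 i *: F i - F ord0 * para s.
Proof.
rewrite (eq_bigr (fun i => x 0 i *: F i - (i == ord0)%:R *: (F i * para s))).
  rewrite sumrB; congr (_ - _).
  rewrite (bigD1 ord0) //= scale1r big1 ?addr0 // => i /negPf ->.
  by rewrite scale0r.
by move=> i _; rewrite half_dQc_unit mulrBr mulr_algr scalerAr.
Qed.

(** This identity is what lowers the power of Qc by one in [Lap_term]. *)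
Lemma sum_half_dQc_sqr x : \sum_i half_dQc (e i) x * half_dQc (e i) x = Qc s x.
Proof.
rewrite sum_half_dQc half_dQc_unit eqxx scale1r /Qc.
rewrite (eq_bigr (fun i => (x 0 i * x 0 i) *: 1 -
  (i == ord0)%:R *: (x 0 i *: para s))); last first.
  by move=> i _; rewrite half_dQc_unit scalerBr !scalerA [_ * _%:R]mulrC.
rewrite sumrB -scaler_suml -[X in X *: _]/(dotv x x) -enorm_sqr.
rewrite (bigD1 ord0) //= scale1r big1 ?addr0 => [|i /negPf ->]; last first.
  by rewrite scale0r.
rewrite mulrBl mulr_algl -expr2; apply: coordP => A; rewrite !coordE; ring.
Qed.

(** Covers D and its conjugate at once: h is x or xb as a linear function of x.
    Since h is linear, the terms x_i h(e_i) coming from the gradient of Qc add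
    up to h x. *)
Lemma dirac_term (h : {linear V -> C}) (a : V -> C) da x k :
  inball x -> h (e ord0) = 1 -> (forall i, is_derive x (e i) a (da i)) ->
  \sum_i h (e i) * partial i (fun y => a y * q y ^+ k) x =
  (\sum_i h (e i) * da i) * q x ^+ k
  - (2 * k)%:R *: ((h x * a x - a x * para s) * q x ^+ k.+1).
Proof.
move=> xs h1 dax.
rewrite (eq_bigr (fun i => h (e i) * da i * q x ^+ k - (2 * k)%:R *:
    ((h (e i) * a x) * half_dQc (e i) x * q x ^+ k.+1))); last first.
  move=> i _; rewrite /partial (derive_val (is_derive := is_derive_term k xs (dax i))).
  by rewrite mulrBr -scalerAr !mulrA.
have hE : \sum_i x 0 i *: (h (e i) * a x) = h x * a x.
  rewrite [in RHS](para_sum h x) mulr_suml.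
  by apply: eq_bigr => i _; rewrite scalerAl.
by rewrite sumrB -mulr_suml -scaler_sumr -mulr_suml sum_half_dQc h1 mul1r hE.
Qed.

(** The ball |y| < |s| is open, so a formula valid on it may be differentiated;
    this is what makes the iterated operators accessible. *)
Lemma partial_eq (f g : V -> C) i : (forall y, inball y -> f y = g y) ->
  forall y, inball y -> partial i f y = partial i g y.
Proof.
move=> fg y ys; apply: near_eq_derive.
by apply: filterS (near_inball ys) => z; exact: fg.
Qed.

Lemma Lap_eq (f g : V -> C) : (forall y, inball y -> f y = g y) ->
  forall y, inball y -> Lap f y = Lap g y.
Proof.
move=> fg y ys; apply: eq_bigr => i _; apply: partial_eq ys.
exact: partial_eq.
Qed.

Lemma DL_eq (f g : V -> C) : (forall y, inball y -> f y = g y) ->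
  forall y, inball y -> DL f y = DL g y.
Proof.
move=> fg y ys; rewrite !DLE; apply: eq_bigr => i _; congr (_ * _).
exact: partial_eq ys.
Qed.

Lemma DbarL_eq (f g : V -> C) : (forall y, inball y -> f y = g y) ->
  forall y, inball y -> DbarL f y = DbarL g y.
Proof.
move=> fg y ys; rewrite !DbarLE; apply: eq_bigr => i _; congr (_ * _).
exact: partial_eq ys.
Qed.

(** [is_derive_term] is applied twice, the second time with a times the half
    derivative of Qc in the role of a.  The coefficient of a Q^-(k+1) combines
    4k(k+1), from the sum of squares, with -2k from each of the n + 1 second
    derivatives of Q. *)
Lemma Lap_term (a : V -> C) da dda x k : inball x ->
  (forall i y, is_derive y (e i) a (da i y)) ->
  (forall i, is_derive x (e i) (da i) (dda i)) ->
  Lap (fun y => a y * q y ^+ k) x =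
  (\sum_i dda i) * q x ^+ k
  - (4 * k)%:R *: ((\sum_i x 0 i *: da i x - da ord0 x * para s) * q x ^+ k.+1)
  + ((4 * k * k.+1)%:R - (2 * k * n.+1)%:R) *: (a x * q x ^+ k.+1).
Proof.
move=> xs dax ddax; rewrite /Lap -sum_half_dQc.
pose w i y := half_dQc (e i) y.
rewrite (eq_bigr (fun i => dda i * q x ^+ k
  - (4 * k)%:R *: (da i x * w i x * q x ^+ k.+1)
  - (2 * k)%:R *: (a x * q x ^+ k.+1)
  + (4 * k * k.+1)%:R *: (a x * (w i x * w i x) * q x ^+ k.+2))); last first.
  move=> i _.
  rewrite (partial_eq (g := fun y => da i y * q y ^+ k
      - (2 * k)%:R *: ((a y * w i y) * q y ^+ k.+1))) //; last first.
    by move=> y ys; exact: (derive_val (is_derive := is_derive_term k ys (dax i y))).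
  have ww : is_derive x (e i) (w i) 1.
    apply: is_derive_eq (is_derive_half_dQc (e i) (e i) x) _.
    rewrite /dotv (bigD1 i) //= mxE !eqxx mul1r big1 ?addr0 ?scale1r //.
    by move=> j /negPf ji; rewrite mxE ji andbF mul0r.
  have d1 := is_derive_term k xs (ddax i).
  have d2 := is_derive_term k.+1 xs (is_derive_cmul (dax i x) ww).
  have d3 := is_deriveB d1 (is_deriveZ (2 * k)%:R d2).
  apply: etrans (derive_val (is_derive := d3)) _.
  rewrite mulr1 mulrDl -[a x * w i x * _]mulrA -/(w i x).
  move: (da i x * _ * _) (a x * _ * _) (a x * _) => u1 u2 u3.
  by apply: coordP => A; rewrite !coordE !natrM; ring.
rewrite !big_split /= !sumrN -mulr_suml -!scaler_sumr -!mulr_suml -mulr_sumr.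
rewrite sum_half_dQc_sqr sumr_const card_ord -[a x *+ _]scaler_nat -scalerAl.
rewrite -[a x * _ * _]mulrA.
rewrite [q x ^+ k.+2]exprS [Qc s x * _]mulrA divrr ?Qc_unit // mul1r -/(w _).
move: (\sum_(i < _) _ * _) (a x * _) => u1 u2.
move: (_ * q x ^+ k) (u1 * _) => u3 u4.
by apply: coordP => A; rewrite !coordE !natrM; ring.
Qed.

End KernelCalculus.

(** * Closed forms of the left kernels in dimension six *)
Section KernelForms.
Local Open Scope ring_scope.
Variable R : realType.
Local Notation n := 5%N.
Local Notation C := (clifford R n).
Local Notation V := 'rV[R]_n.+1.
Variable s : V.
Implicit Types (a b c : C) (x v w : V).

Local Notation e i := (delta_mx 0 i : V).
Local Notation inball := (fun x : V => enorm x < enorm s).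
Local Notation q x := (Qc s x)^-1.

(** (s - xb)^k with xb on the left and s on the right, so that num_k Q^-k is
    1 / (s - x)^k. *)
Definition num1 x : C := sylvester s (paraconj x) 1.
Definition num2 x : C := sylvester s (paraconj x) (num1 x).
Definition num3 x : C := sylvester s (paraconj x) (num2 x).

(** The numerator of the kernel of Db over Q^2, that is
    4 (s - x)(s - xb) + 2 (s - xb)^2. *)
Definition numDbar x : C := 4 *: Qc s x + 2 *: num2 x.

Lemma num1E x : num1 x = para s - paraconj x.
Proof. by rewrite /num1 /sylvester mul1r mulr1. Qed.

Lemma SLE x : SL s x = num1 x * q x ^+ 1.
Proof. by rewrite num1E expr1. Qed.

Lemma paraE x : para x = (2 * x 0 ord0)%:A - paraconj x.
Proof. by rewrite paraconjE opprB addrC subrK. Qed.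

Lemma paraconj_sqr x : paraconj x * paraconj x =
  (2 * x 0 ord0) *: paraconj x - (enorm x ^+ 2)%:A.
Proof.
rewrite -para_mul_conj paraE; move: (paraconj x) => y.
by rewrite mulrBl mulr_algl opprB addrCA subrr addr0.
Qed.

Lemma num2E x : num2 x = para s * para s - 2 *: (paraconj x * para s)
  + (2 * x 0 ord0) *: paraconj x - (enorm x ^+ 2)%:A.
Proof.
rewrite /num2 /sylvester num1E -[RHS]addrA -paraconj_sqr.
move: (para s) (paraconj x) => p y; rewrite mulrBl mulrBr.
by apply: coordP => A; rewrite !coordE; ring.
Qed.

Lemma numDbarE x : numDbar x = 6 *: (para s * para s)
  - (8 * x 0 ord0) *: para s - 4 *: (paraconj x * para s)
  + (4 * x 0 ord0) *: paraconj x + (2 * enorm x ^+ 2)%:A.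
Proof.
rewrite /numDbar num2E /Qc expr2.
by apply: coordP => A; rewrite !coordE; ring.
Qed.

Lemma sum_para_paraconj : \sum_i para (e i) * paraconj (e i) = 6%:A.
Proof.
rewrite big_ord_recl para_unit0 paraconj_unit0 mulr1.
rewrite (eq_bigr (fun=> 1)) => [|i _]; last first.
  by rewrite para_unitS paraconj_unitS mulrN gen_sqr opprK.
by rewrite sumr_const card_ord -scaler_nat; apply: coordP => A; rewrite !coordE; ring.
Qed.

Lemma sum_paraconj_sqr : \sum_i paraconj (e i) * paraconj (e i) = (- 4)%:A.
Proof.
rewrite big_ord_recl paraconj_unit0 mulr1.
rewrite (eq_bigr (fun=> -1)) => [|i _]; last first.
  by rewrite paraconj_unitS mulrNN gen_sqr.
by rewrite sumr_const card_ord -scaler_nat; apply: coordP => A; rewrite !coordE; ring.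
Qed.

Lemma is_derive_num1 v x : is_derive x v num1 (- paraconj v).
Proof.
apply: is_derive_affine => h; rewrite !num1E (linearP (@paraconj R n)) /=.
move: (para s) (paraconj x) (paraconj v) => p y z.
by apply: coordP => A; rewrite !coordE; ring.
Qed.

Lemma Qc_mulVX x k : inball x -> Qc s x * q x ^+ k.+1 = q x ^+ k.
Proof. by move=> xs; rewrite exprS mulrA divrr ?Qc_unit // mul1r. Qed.

Lemma DL_term (a : V -> C) da x k :
  inball x -> (forall i, is_derive x (e i) a (da i)) ->
  DL (fun y => a y * q y ^+ k) x = (\sum_i para (e i) * da i) * q x ^+ k
  - (2 * k)%:R *: ((para x * a x - a x * para s) * q x ^+ k.+1).
Proof. by move=> xs dax; rewrite DLE (dirac_term k xs (para_unit0 _ _) dax). Qed.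

Lemma DbarL_term (a : V -> C) da x k :
  inball x -> (forall i, is_derive x (e i) a (da i)) ->
  DbarL (fun y => a y * q y ^+ k) x = (\sum_i paraconj (e i) * da i) * q x ^+ k
  + (2 * k)%:R *: (sylvester s (paraconj x) (a x) * q x ^+ k.+1).
Proof.
move=> xs dax; rewrite DbarLE (dirac_term k xs (paraconj_unit0 _ _) dax).
by rewrite -scalerN -mulNr opprB.
Qed.

(** (s - x)(s - xb) = Q up to sign: applying D to SL lowers the power of
    Q^-1. *)
Lemma para_num1 x : para x * num1 x - num1 x * para s = - Qc s x.
Proof.
rewrite num1E /Qc; move: (para_mul_conj x); rewrite expr2 (paraE x).
move: (para s) (paraconj x) => p y yy.
rewrite mulrBr yy !mulrBl mulr_algl.
by apply: coordP => A; rewrite !coordE; ring.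
Qed.

Lemma DL_SL x : inball x -> DL (SL s) x = (- 4)%:A * q x ^+ 1.
Proof.
move=> xs; rewrite (DL_eq (s := s) (g := fun y => num1 y * q y ^+ 1)) //; last first.
  by move=> y _; rewrite SLE.
rewrite (DL_term 1 xs (fun i => is_derive_num1 (e i) x)).
under eq_bigr do rewrite mulrN.
rewrite sumrN sum_para_paraconj para_num1 [- Qc s x * _]mulNr Qc_mulVX //.
move: (q x ^+ 1) => c; rewrite mulNr !mulr_algl.
by apply: coordP => A; rewrite !coordE; ring.
Qed.

Lemma is_derive_num1Z (k : R) v x :
  is_derive x v (fun y => k *: num1 y) (k *: - paraconj v).
Proof. exact: (is_deriveZ k (is_derive_num1 v x)). Qed.

Lemma Lap_SL x : inball x -> Lap (SL s) x = (- 8 *: num1 x) * q x ^+ 2.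
Proof.
move=> xs; rewrite (Lap_eq (s := s) (g := fun y => num1 y * q y ^+ 1)) //; last first.
  by move=> y _; rewrite SLE.
rewrite (Lap_term 1 xs (fun i y => is_derive_num1 (e i) y)
  (fun i => is_derive_cst (- paraconj (e i)) x (e i))).
rewrite paraconj_unit0 big1 // mul0r add0r.
under eq_bigr do rewrite scalerN.
rewrite sumrN -(para_sum (@paraconj R n)) /= mulN1r opprK [_ + para s]addrC -num1E.
rewrite [LHS]addrC -scaleNr -scalerDl -scalerAl; congr (_ *: _).
by rewrite !natrM; ring.
Qed.

Lemma LapDL_SL x : inball x -> Lap (DL (SL s)) x = 16%:A * q x ^+ 2.
Proof.
move=> xs; rewrite (Lap_eq (g := fun y => cst ((- 4)%:A : C) y * q y ^+ 1) DL_SL) //.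
rewrite (Lap_term 1 xs (fun i y => is_derive_cst ((- 4)%:A : C) y (e i))
  (fun i => is_derive_cst (0 : C) x (e i))).
rewrite /cst !big1 // => [|i _]; last by rewrite scaler0.
rewrite !mul0r subr0 mul0r scaler0 subr0 add0r -scalerAl mul1r.
rewrite -scalerAl mul1r scalerA; congr (_ *: _).
by rewrite !natrM; ring.
Qed.

Lemma D2_SL x : inball x ->
  DL (DL (SL s)) x = (- 8 *: (para s - para x)) * q x ^+ 2.
Proof.
move=> xs; rewrite (DL_eq (g := fun y => cst ((- 4)%:A : C) y * q y ^+ 1) DL_SL) //.
rewrite (DL_term 1 xs (fun i => is_derive_cst ((- 4)%:A : C) x (e i))).
rewrite /cst !big1 // => [|i _]; last by rewrite mulr0.
rewrite mul0r sub0r mulr_algl mulr_algr -scalerBr -scalerAl scalerA -scaleNr.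
rewrite -scalerAl -[para x - _]opprB mulNr scalerN -scaleNr; congr (_ *: _).
by rewrite natrM; ring.
Qed.

Lemma DLLap_SL x : inball x -> DL (Lap (SL s)) x = 16%:A * q x ^+ 2.
Proof.
move=> xs; rewrite (DL_eq (g := fun y => (- 8 *: num1 y) * q y ^+ 2) Lap_SL) //.
rewrite (DL_term 2 xs (fun i => is_derive_num1Z (- 8) (e i) x)).
under eq_bigr do rewrite -scalerAr mulrN scalerN -scaleNr.
rewrite -scaler_sumr sum_para_paraconj.
have -> : para x * (- 8 *: num1 x) - (- 8 *: num1 x) * para s = 8 *: Qc s x.
  by rewrite -scalerAr -scalerAl -scalerBr para_num1 scaleNr scalerN opprK.
rewrite scalerA !mulr_algl -[8 *: _ * _]scalerAl Qc_mulVX //.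
by apply: coordP => A; rewrite !coordE; ring.
Qed.

Lemma DbarLap_SL x : inball x -> DbarL (Lap (SL s)) x =
  - 32 *: (q x ^+ 2 + num2 x * q x ^+ 3).
Proof.
move=> xs; rewrite (DbarL_eq (g := fun y => (- 8 *: num1 y) * q y ^+ 2) Lap_SL) //.
rewrite (DbarL_term 2 xs (fun i => is_derive_num1Z (- 8) (e i) x)).
under eq_bigr do rewrite -scalerAr mulrN scalerN -scaleNr.
rewrite -scaler_sumr sum_paraconj_sqr.
have -> : sylvester s (paraconj x) (- 8 *: num1 x) = - 8 *: num2 x.
  by rewrite /num2 /sylvester -scalerAr -scalerAl scalerBr.
rewrite scalerA -!scalerAl mul1r.
by apply: coordP => A; rewrite !coordE; ring.
Qed.

Lemma DbarL_SL x : inball x -> DbarL (SL s) x = numDbar x * q x ^+ 2.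
Proof.
move=> xs; rewrite (DbarL_eq (s := s) (g := fun y => num1 y * q y ^+ 1)) //; last first.
  by move=> y _; rewrite SLE.
rewrite (DbarL_term 1 xs (fun i => is_derive_num1 (e i) x)).
under eq_bigr do rewrite mulrN.
rewrite sumrN sum_paraconj_sqr -scaleNr opprK mulr_algl -/(num2 x) /numDbar.
by rewrite [RHS]mulrDl -!scalerAl Qc_mulVX.
Qed.

(** [para_polar] rewritten in the conjugates alone, which is the form produced
    by differentiating xb^2. *)
Lemma paraconj_polar x i : paraconj x * paraconj (e i) + paraconj (e i) * paraconj x
  = (2 * (i == ord0)%:R) *: paraconj x + (2 * x 0 ord0) *: paraconj (e i)
    - (2 * x 0 i)%:A.
Proof.
have := para_polar x (e i); rewrite (paraE x) (paraE (e i)) mxE eqxx /= eq_sym.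
have -> : dotv x (e i) = x 0 i.
  rewrite dotvC /dotv (bigD1 i) //= mxE !eqxx mul1r big1 ?addr0 // => j /negPf ji.
  by rewrite mxE ji andbF mul0r.
move: (paraconj x) (paraconj (e i)) => y z <-.
rewrite !mulrBl !mulr_algl.
by apply: coordP => A; rewrite !coordE; ring.
Qed.

Definition dnumDbar i x : C := 8 *: half_dQc s (e i) x
  + (4 * (i == ord0)%:R) *: paraconj x + (4 * x 0 ord0) *: paraconj (e i)
  - (4 * x 0 i)%:A - 4 *: (paraconj (e i) * para s).

Lemma is_derive_numDbar i x : is_derive x (e i) numDbar (dnumDbar i x).
Proof.
have d1 := is_derive_num1 (e i) x.
have dp := is_derive_cst (para s : C) x (e i).
have dy := is_derive_linear (@paraconj R n) x (e i).
have dQ := is_deriveZ 4 (is_derive_Qc s x (e i)).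
have d2 := is_deriveZ 2 (is_deriveB (is_derive_cmul d1 dp) (is_derive_cmul dy d1)).
have dA := is_deriveD dQ d2; apply: is_derive_eq dA _.
rewrite /dnumDbar /cst mulr0 add0r num1E.
have := paraconj_polar x i; rewrite /=.
move: (half_dQc s _ x) (paraconj x) (paraconj (e i)) (para s) => w y z p yz.
rewrite mulrBr !mulNr mulrN.
have -> : z * y = (2 * (i == ord0)%:R) *: y + (2 * x 0 ord0) *: z - (2 * x 0 i)%:A
  - y * z by rewrite -yz addrC addKr.
by apply: coordP => A; rewrite !coordE; ring.
Qed.

Lemma is_derive_dnumDbar i x : is_derive x (e i) (dnumDbar i)
  (4%:A + (8 * (i == ord0)%:R) *: paraconj (e i)).
Proof.
apply: is_derive_affine => h; rewrite /dnumDbar !half_dQc_unit (linearP (@paraconj R n)) /=.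
rewrite !mxE !eqxx /= (eq_sym ord0 i).
move: (paraconj x) (paraconj (e i)) (para s) => y z p.
by apply: coordP => A; rewrite !coordE; ring.
Qed.

Lemma sum_unit (F : 'I_n.+1 -> C) : \sum_i (i == ord0)%:R *: F i = F ord0.
Proof.
rewrite (bigD1 ord0) //= scale1r big1 ?addr0 // => i /negPf ->.
by rewrite scale0r.
Qed.

Lemma sum_dnumDbar x :
  \sum_i paraconj (e i) * dnumDbar i x = 8 *: (para s - para x).
Proof.
rewrite (eq_bigr (fun i => 8 *: (paraconj (e i) * half_dQc s (e i) x)
  + 4 *: ((i == ord0)%:R *: (paraconj (e i) * paraconj x))
  + (4 * x 0 ord0) *: (paraconj (e i) * paraconj (e i))
  - 4 *: (x 0 i *: paraconj (e i))
  - 4 *: ((paraconj (e i) * paraconj (e i)) * para s))); last first.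
  move=> i _; rewrite /dnumDbar.
  move: (half_dQc _ _ _) (paraconj x) (paraconj (e i)) (para s) => w y z p.
  rewrite !mulrBr !mulrDr -!scalerAr mulr1 mulrA.
  by apply: coordP => A; rewrite !coordE; ring.
rewrite !big_split /= !sumrN -!scaler_sumr -mulr_suml sum_half_dQc sum_unit.
rewrite sum_paraconj_sqr -(para_sum (@paraconj R n)) /= paraconj_unit0 !mul1r.
rewrite (paraE x); move: (paraconj x) (para s) => y p; rewrite mulr_algl.
by apply: coordP => A; rewrite !coordE; ring.
Qed.

(** Euler's identity for [numDbar], which has degree 2 in (x, s).  It depends on
    x and s only through s - x and s - xb, so its s-derivative is minus its
    x_0-derivative. *)
Lemma euler_numDbar x :
  \sum_i x 0 i *: dnumDbar i x - dnumDbar ord0 x * para s = 2 *: numDbar x.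
Proof.
rewrite (eq_bigr (fun i => (4 * (x 0 i * x 0 i)) *: 1
  - 8 *: ((i == ord0)%:R *: (x 0 i *: para s))
  + 4 *: ((i == ord0)%:R *: (x 0 i *: paraconj x))
  + (4 * x 0 ord0) *: (x 0 i *: paraconj (e i))
  - 4 *: ((x 0 i *: paraconj (e i)) * para s))); last first.
  move=> i _; rewrite /dnumDbar half_dQc_unit.
  move: (paraconj x) (paraconj (e i)) (para s) => y z p.
  rewrite -scalerAl.
  by apply: coordP => A; rewrite !coordE; ring.
rewrite !big_split /= !sumrN -!scaler_sumr -scaler_suml -mulr_sumr -mulr_suml.
rewrite !sum_unit -(para_sum (@paraconj R n)) /=.
rewrite -[X in (4 * X) *: 1]/(dotv x x) -enorm_sqr.
rewrite /dnumDbar half_dQc_unit paraconj_unit0 numDbarE eqxx (_ : true%:R = 1 :> R) //.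
move: (paraconj x) (para s) => y p.
rewrite !mulrBl !mulrDl -!scalerAl !mulrBl !mul1r -!scalerAl mul1r.
by apply: coordP => A; rewrite !coordE; ring.
Qed.

Lemma LapDbar_SL x : inball x -> Lap (DbarL (SL s)) x =
  - 32 *: (q x ^+ 2 + num2 x * q x ^+ 3).
Proof.
move=> xs; rewrite (Lap_eq (g := fun y => numDbar y * q y ^+ 2) DbarL_SL) //.
rewrite (Lap_term 2 xs is_derive_numDbar (fun i => is_derive_dnumDbar i x)).
rewrite euler_numDbar big_split sumr_const card_ord /=.
under eq_bigr do rewrite mulrC -scalerA.
rewrite sum_unit paraconj_unit0 /numDbar -[4%:A *+ _]scaler_nat.
have -> : 2 *: (4 *: Qc s x + 2 *: num2 x) * q x ^+ 3 =
    8 *: q x ^+ 2 + 4 *: (num2 x * q x ^+ 3).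
  rewrite -(Qc_mulVX 2 xs); move: (Qc s x) (num2 x) (q x ^+ 3) => Q a c.
  by rewrite -scalerAl mulrDl -!scalerAl; apply: coordP => A; rewrite !coordE; ring.
rewrite [(6%N%:R *: _ + _)](_ : _ = 32%:A); last first.
  by apply: coordP => A; rewrite !coordE; ring.
rewrite mulr_algl; move: (q x ^+ 2) (_ * q x ^+ 3) (_ * q x ^+ 3) => c d f.
by apply: coordP => A; rewrite !coordE !natrM; ring.
Qed.

Lemma Dbar2_SL x : inball x -> DbarL (DbarL (SL s)) x =
  8 *: ((para s - para x) * q x ^+ 2) + 16 *: (num1 x * q x ^+ 2)
  + 8 *: (num3 x * q x ^+ 3).
Proof.
move=> xs; rewrite (DbarL_eq (g := fun y => numDbar y * q y ^+ 2) DbarL_SL) //.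
rewrite (DbarL_term 2 xs (fun i => is_derive_numDbar i x)) sum_dnumDbar.
rewrite -scalerAl -[RHS]addrA; congr (_ + _).
rewrite /numDbar sylvesterD !sylvesterZ -/(num3 x).
have -> : sylvester s (paraconj x) (Qc s x) = num1 x * Qc s x.
  by rewrite -{1}[Qc s x]mul1r sylvesterM //; exact: Qc_comm.
rewrite -(Qc_mulVX 2 xs).
move: (num1 x) (num3 x) (Qc s x) (q x ^+ 3) => a b Q c.
rewrite mulrDl -!scalerAl mulrA.
by apply: coordP => A; rewrite !coordE; ring.
Qed.

End KernelForms.

(** * Negative binomial expansions *)
Definition sums_to (R : realType) (n : nat) (t : nat -> clifford R n)
    (F : clifford R n) : Prop :=
  ((fun N => \sum_(m < N) t m) @ \oo --> F)%classic.

Section Series.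
Local Open Scope classical_set_scope.
Local Open Scope ring_scope.
Variables (R : realType) (n : nat).
Local Notation C := (clifford R n).
Local Notation V := 'rV[R]_n.+1.
Variables (s x : V).
Hypothesis xs : enorm x < enorm s.
Implicit Types (a b c f g y z : C).

Local Notation X := (para x).
Local Notation X' := (paraconj x).
Local Notation S := (para s).
Local Notation q := (Qc s x)^-1.

(** Division by s - y for the conjugate y of z, as multiplication by
    (s - z) Q^-1. *)
Definition resolve z g : C := sylvester s z g * q.

Lemma enorm_s_gt0 : 0 < enorm s.
Proof. exact: le_lt_trans (sqrtr_ge0 _) xs. Qed.

Lemma S_unit : S \is a GRing.unit.
Proof. by apply: para_unit; rewrite gt_eqF ?enorm_s_gt0. Qed.

(** The pairs (x, xb) and (xb, x): what is needed for
    (s - z)(s - y) = Q. *)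
Definition conj_pair y z := y + z = X + X' /\ z * y = X * X'.

Lemma conj_pair_paraconj : conj_pair X X'.
Proof. by split=> //; rewrite para_comm. Qed.

Lemma conj_pair_para : conj_pair X' X.
Proof. by split=> //; rewrite addrC. Qed.

Lemma sylvester_conj y z g : conj_pair y z ->
  sylvester s z (sylvester s y g) = g * Qc s x.
Proof.
move=> [yz zy]; rewrite QcE -yz -zy.
have [k kE] : exists k : R, y + z = k%:A.
  by exists (2 * x 0 ord0); rewrite yz paraconjE addrC subrK.
have [l lE] : exists l : R, z * y = l%:A.
  by exists (enorm x ^+ 2); rewrite zy para_mul_conj.
rewrite /sylvester expr2; move: S => p.
have -> : (g * p - y * g) * p - z * (g * p - y * g) =
    g * (p * p) - (y + z) * (g * p) + z * y * g.
  rewrite mulrBl mulrBr mulrDl !mulrA.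
  by apply: coordP => A; rewrite !coordE; ring.
by rewrite kE lE !mulr_algl mulrDr mulrBr mulr_algr -scalerAr.
Qed.

Lemma resolveM y g c : GRing.comm c S -> GRing.comm c q ->
  resolve y (g * c) = resolve y g * c.
Proof. by move=> cs cq; rewrite /resolve sylvesterM // -!mulrA cq. Qed.

Lemma resolve_unique y z f g : conj_pair y z ->
  sylvester s y f = g -> f = resolve z g.
Proof.
move=> yz <-; rewrite /resolve (sylvester_conj _ yz) mulrK //.
exact: Qc_unit.
Qed.

(** Dividing by s - y and by s - z is dividing by Q. *)
Lemma resolve_conj y z g : conj_pair y z -> resolve z (resolve y g) = g * q.
Proof.
move=> yz; rewrite /resolve sylvesterM ?(sylvester_conj _ yz) ?mulrK //.
  exact: Qc_unit.
exact: Qc_inv_comm.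
Qed.

Local Notation v := (S^-1).

(** Multiplying the partial sums of sum A_m s^-(m+c+1) by s - y telescopes; the
    last term is the error made by truncating at N. *)
Lemma sum_step y (A B : nat -> C) (c N : nat) :
  A 0%N = B 0%N -> (forall m, A m.+1 = y * A m + B m.+1) ->
  sylvester s y (\sum_(m < N) A m * v ^+ (m + c.+1)) =
  \sum_(m < N.+1) B m * v ^+ (m + c) - A N * v ^+ (N + c).
Proof.
move=> A0 AS.
have vS m : v ^+ (m + c.+1) * S = v ^+ (m + c).
  by rewrite addnS exprSr -mulrA mulVr ?S_unit // mulr1.
elim: N => [|N IH].
  by rewrite big_ord0 /sylvester mul0r mulr0 subr0 big_ord1 A0 subrr.
rewrite big_ord_recr /= [RHS]addrC big_ord_recr /=.
rewrite sylvesterD IH /sylvester -[A N * _ * S]mulrA vS AS.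
move: (\sum_(_ < _) _) => u; rewrite mulrDl addSnnS mulrA.
by apply: coordP => D; rewrite !coordE; ring.
Qed.

Lemma resolve_cvg (u : nat -> C) z f :
  u @ \oo --> f -> resolve z (u m) @[m --> \oo] --> resolve z f.
Proof.
move=> uf; apply: cvgMc; last exact: cvg_cst.
by apply: cvgB; apply: cvgMc => //; exact: cvg_cst.
Qed.

Lemma series_step y z (A B : nat -> C) (c : nat) f : conj_pair y z ->
  A 0%N = B 0%N -> (forall m, A m.+1 = y * A m + B m.+1) ->
  A m * v ^+ m @[m --> \oo] --> 0 ->
  (\sum_(m < N) B m * v ^+ (m + c)) @[N --> \oo] --> f ->
  (\sum_(m < N) A m * v ^+ (m + c.+1)) @[N --> \oo] --> resolve z f.
Proof.
move=> yz A0 AS Av Bf.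
have E N : \sum_(m < N) A m * v ^+ (m + c.+1) =
    resolve z (\sum_(m < N.+1) B m * v ^+ (m + c) - A N * v ^+ (N + c)).
  exact/(resolve_unique yz)/sum_step.
under eq_fun do rewrite E.
apply: resolve_cvg; rewrite -[f]subr0; apply: cvgB.
  by rewrite (cvg_shiftS (fun N => \sum_(m < N) B m * v ^+ (m + c))).
have -> : (fun N => A N * v ^+ (N + c)) = (fun N => A N * v ^+ N * v ^+ c).
  by apply/funext => N; rewrite exprD mulrA.
by rewrite -(mul0r (v ^+ c)); apply: cvgMc => //; exact: cvg_cst.
Qed.

Lemma sqnorm_mulV g : sqnorm (g * v) = sqnorm g / enorm s ^+ 2.
Proof.
have s0 : enorm s ^+ 2 != 0 by rewrite expf_neq0 // gt_eqF ?enorm_s_gt0.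
apply: (mulIf s0); rewrite mulfVK // mulrC -sqnorm_mulr -mulrA mulVr ?S_unit //.
by rewrite mulr1.
Qed.

(** The factor by which g |-> y g s^-1 scales the square of the Euclidean
    norm. *)
Definition rate : R := enorm x ^+ 2 / enorm s ^+ 2.

Lemma rate_ge0 : 0 <= rate.
Proof. by rewrite divr_ge0 // sqr_ge0. Qed.

Lemma rate_lt1 : rate < 1.
Proof.
rewrite /rate ltr_pdivrMr ?exprn_gt0 ?enorm_s_gt0 // mul1r.
by rewrite ltr_sqr // nnegrE ?sqrtr_ge0.
Qed.

Definition geometric_bound (u : nat -> C) (t : R) :=
  exists K, forall m, sqnorm (u m) <= K * t ^+ m.

(** If B_m s^-m decays like t^m with t larger than the contraction rate of the
    recursion, so does A_m s^-m.  The strict inequality leaves room for the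
    factor 1 + d of [sqnorm_addr]. *)
Lemma geometric_step y (A B : nat -> C) t : rate < t ->
  (forall g, sqnorm (y * g) = enorm x ^+ 2 * sqnorm g) ->
  A 0%N = B 0%N -> (forall m, A m.+1 = y * A m + B m.+1) ->
  geometric_bound (fun m => B m * v ^+ m) t ->
  geometric_bound (fun m => A m * v ^+ m) t.
Proof.
move=> rt ny A0 AS [K BK].
have t0 : 0 < t by exact: le_lt_trans rate_ge0 rt.
have [d d0 dt] : exists2 d, 0 < d & (1 + d) * rate < t.
  exists ((t - rate) / 2 / (1 + rate)).
    by rewrite !divr_gt0 ?subr_gt0 //; have := rate_ge0; lra.
  have r0 := rate_ge0; have r1 : 0 < 1 + rate by lra.
  suff : (t - rate) / 2 / (1 + rate) * rate <= (t - rate) / 2.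
    by move: ((t - rate) / 2 / (1 + rate)) => d dr; rewrite mulrDl mul1r; lra.
  rewrite -mulrA ger_pMr ?divr_gt0 ?subr_gt0 //.
  by rewrite mulrC ler_pdivrMr // mul1r; lra.
have K0 : 0 <= K.
  by have := BK 0%N; rewrite !expr0 !mulr1; exact: le_trans (sqnorm_ge0 _).
pose K1 := (1 + d^-1) * K; pose k := (1 + d) * rate.
have K10 : 0 <= K1 by rewrite mulr_ge0 // addr_ge0 ?invr_ge0 // ltW.
have tk : 0 < t - k by rewrite subr_gt0.
(* the fixed point of the recursion for the constant, k K' + K1 t = K' t,
   plus K to start the induction *)
exists (K + K1 * t / (t - k)).
have Q0 : 0 <= K1 * t / (t - k) by apply: divr_ge0; [apply: mulr_ge0 => //|]; exact: ltW.
elim=> [|m IH].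
  rewrite A0; apply: le_trans (BK 0%N) _.
  by apply: ler_wpM2r; [apply: exprn_ge0; exact: ltW|rewrite lerDl].
rewrite AS mulrDl.
apply: le_trans (sqnorm_addr _ _ d0) _.
have -> : sqnorm (y * A m * v ^+ m.+1) =
    enorm x ^+ 2 * (sqnorm (A m * v ^+ m) / enorm s ^+ 2).
  by rewrite -mulrA ny; congr (_ * _); rewrite exprSr mulrA sqnorm_mulV.
have -> : (1 + d) * (enorm x ^+ 2 * (sqnorm (A m * v ^+ m) / enorm s ^+ 2))
    = k * sqnorm (A m * v ^+ m) by rewrite /k /rate; ring.
have k0 : 0 <= k by rewrite mulr_ge0 ?rate_ge0 // addr_ge0 // ltW.
have h1 := ler_wpM2l k0 IH.
have h2 : (1 + d^-1) * sqnorm (B m.+1 * v ^+ m.+1) <= K1 * t ^+ m.+1.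
  rewrite /K1 -mulrA; apply: ler_wpM2l (BK _).
  by rewrite addr_ge0 // invr_ge0 ltW.
apply: le_trans (lerD h1 h2) _.
have tm : 0 <= t ^+ m by rewrite exprn_ge0 // ltW.
rewrite exprS mulrA mulrA -mulrDl mulrA; apply: ler_wpM2r => //.
have : K1 * t = K1 * t / (t - k) * (t - k) by rewrite mulfVK // gt_eqF.
move: (K1 * t / (t - k)) Q0 => Q Q0 ->; have h := mulr_ge0 K0 (ltW tk).
by rewrite -subr_ge0 (_ : _ - _ = K * (t - k)) //; ring.
Qed.

Lemma geometric_cvg0 (u : nat -> C) t : 0 <= t < 1 -> geometric_bound u t ->
  u @ \oo --> (0 : C).
Proof.
move=> /andP[t0 t1] [K uK]; apply: cvg_clifford => A.
rewrite [coord 0 A](_ : _ = 0); last by rewrite /coord mxE.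
have sq0 : coord (u m) A ^+ 2 @[m --> \oo] --> (0 : R).
  apply: (@squeeze_cvgr _ _ _ _ (fun=> 0) (geometric K t)).
  - apply: nearW => m; rewrite sqr_ge0 /=.
    exact: le_trans (coord_sqnorm _ _) (uK m).
  - exact: cvg_cst.
  - by apply: cvg_geometric; rewrite ger0_norm.
apply/norm_cvg0P; rewrite -[X in _ --> X](@sqrtr0 R).
have -> : (fun m => `|coord (u m) A|) = (fun m => Num.sqrt (coord (u m) A ^+ 2)).
  by apply/funext => m; rewrite sqrtr_sqr.
exact: (cvg_comp _ _ sq0 (@sqrt_continuous R 0)).
Qed.

(** The coefficient of z^a in (1 - z)^-p, also for p = 0, where the truncated
    predecessor makes it 1 for a = 0 and 0 otherwise. *)
Definition negbin (p a : nat) : nat := 'C((a + p).-1, a).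

Lemma negbin0 p : negbin p 0 = 1%N.
Proof. exact: bin0. Qed.

Lemma negbin0S (a : nat) : negbin 0 a.+1 = 0%N.
Proof. by rewrite /negbin addn0 bin_small. Qed.

Lemma negbinSS (p a : nat) : negbin p.+1 a.+1 = (negbin p.+1 a + negbin p a.+1)%N.
Proof. by rewrite /negbin !addnS addSn /= binS addnC. Qed.

(** The coefficient of z^m in (1 - x z)^-p (1 - xb z)^-r. *)
Definition hcoef (p r m : nat) : C :=
  \sum_(b < m.+1) (negbin p (m - b) * negbin r b)%:R *: (X ^+ (m - b) * X' ^+ b).

Lemma hcoef0 p r : hcoef p r 0 = 1.
Proof. by rewrite /hcoef big_ord1 !negbin0 scale1r mulr1. Qed.

Lemma hcoefSl p r m :
  hcoef p.+1 r m.+1 = X * hcoef p.+1 r m + hcoef p r m.+1.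
Proof.
rewrite /hcoef big_ord_recr [X in _ = _ + X]big_ord_recr /= subnn !negbin0 addrA.
congr (_ + _); rewrite mulr_sumr -big_split; apply: eq_bigr => b _ /=.
have bm : (b <= m)%N by rewrite -ltnS.
rewrite subSn // negbinSS -scalerAr exprS !mulrA -scalerDl -natrD.
by rewrite mulnDl.
Qed.

Lemma hcoefSr p r m :
  hcoef p r.+1 m.+1 = X' * hcoef p r.+1 m + hcoef p r m.+1.
Proof.
rewrite /hcoef big_ord_recl [X in _ = _ + X]big_ord_recl /= !negbin0 addrCA.
congr (_ + _); rewrite mulr_sumr -big_split; apply: eq_bigr => b _ /=.
rewrite /bump /= add1n subSS negbinSS -scalerAr exprS mulrA.
have -> : X' * (X ^+ (m - b) * X' ^+ b) = X ^+ (m - b) * X' * X' ^+ b.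
  by rewrite mulrA; congr (_ * _); apply/commrX; rewrite /GRing.comm para_comm.
by rewrite -scalerDl -natrD mulnDr.
Qed.

(** 1 / ((s - x)^p (s - xb)^r). *)
Definition hvalue (p r : nat) : C := iter p (resolve X') (iter r (resolve X) 1).

Lemma sqnorm_paraconj g : sqnorm (X' * g) = enorm x ^+ 2 * sqnorm g.
Proof.
rewrite !sqnormEl cconjM -mulrA [cconj X' * _]mulrA paraconjE.
rewrite linearB linearZ /= cconj1 cconj_para -paraconjE.
have -> : (2 * x 0 ord0)%:A - X' = X by rewrite paraconjE opprB addrC subrK.
by rewrite para_mul_conj mulr_algl -scalerAr coordZ.
Qed.

(** Each factor 1 / (s - x) or 1 / (s - xb) raises p or r by one, and the
    coefficients follow the recursions [hcoefSl] and [hcoefSr].  The geometric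
    bound is carried along because the next step needs the decay of the
    terms. *)
Lemma hseries t p r : rate < t < 1 ->
  geometric_bound (fun m => hcoef p r m * v ^+ m) t /\
  (\sum_(m < N) hcoef p r m * v ^+ (m + (p + r))) @[N --> \oo] --> hvalue p r.
Proof.
move=> /andP[rt t1].
have t01 : 0 <= t < 1 by rewrite t1 andbT (le_trans rate_ge0) ?ltW.
elim: p => [|p [bp IHp]]; last first.
  have b : geometric_bound (fun m => hcoef p.+1 r m * v ^+ m) t.
    apply: geometric_step bp => //; first exact: sqnorm_mull.
      by rewrite !hcoef0.
    by move=> m; rewrite hcoefSl.
  split=> //; rewrite addSn; apply: series_step IHp => //.
  - exact: conj_pair_paraconj.
  - by rewrite !hcoef0.
  - by move=> m; rewrite hcoefSl.
  - exact: geometric_cvg0 b.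
elim: r => [|r [br IHr]]; last first.
  have b : geometric_bound (fun m => hcoef 0 r.+1 m * v ^+ m) t.
    apply: geometric_step br => //; first exact: sqnorm_paraconj.
      by rewrite !hcoef0.
    by move=> m; rewrite hcoefSr.
  split=> //; rewrite add0n; apply: series_step IHr => //.
  - exact: conj_pair_para.
  - by rewrite !hcoef0.
  - by move=> m; rewrite hcoefSr.
  - exact: geometric_cvg0 b.
have hS m : hcoef 0 0 m.+1 = 0.
  rewrite /hcoef big1 // => b _; case: (nat_of_ord b) => [|b'].
    by rewrite subn0 negbin0S mul0n scale0r.
  by rewrite negbin0S muln0 scale0r.
split.
  exists (sqnorm (1 : C)); case=> [|m].
    by rewrite hcoef0 !expr0 !mulr1.
  rewrite hS mul0r /sqnorm big1 => [|A _]; last by rewrite /coord mxE expr0n.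
  by rewrite mulr_ge0 ?sqnorm_ge0 // exprn_ge0 // (le_trans rate_ge0) ?ltW.
apply: cvg_near_cst; exists 1%N => // N /= N0.
rewrite -(prednK N0) big_ord_recl hcoef0 expr0 mulr1 big1 ?addr0 // => i _.
by rewrite lift0 hS mul0r.
Qed.

Lemma hseries_cvg p r :
  sums_to (fun m => hcoef p r m * v ^+ (m + (p + r))) (hvalue p r).
Proof.
have /andP[] : rate < (rate + 1) / 2 < 1 by have := rate_lt1; lra.
by move=> r1 r2; case: (@hseries ((rate + 1) / 2) p r); rewrite ?r1.
Qed.

End Series.

Arguments hseries_cvg {R n s x} xs (p r)%_N.

(** * Transfer to the right kernels *)
Section Expansions.
Local Open Scope classical_set_scope.
Local Open Scope ring_scope.
Variables (R : realType) (n : nat).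
Local Notation C := (clifford R n).
Local Notation V := 'rV[R]_n.+1.
Implicit Types (s x : V) (f : V -> C) (K : C).

(** Reindexes the series from its first index m0 to 0. *)
Lemma expansion_cvg K (c : R) m0 (u t : nat -> C) F :
  (forall i, u (i + m0)%N = t i) ->
  sums_to t F -> K = c *: F -> expansion K c m0 u.
Proof.
move=> ut; rewrite /sums_to => tF ->.
have uF : (\sum_(m0 <= m < N) u m) @[N --> \oo] --> F.
  have -> : (fun N => \sum_(m0 <= m < N) u m) =
      (fun N => (fun M => \sum_(i < M) t i) (N - m0)%N).
    apply/funext => N; rewrite -{1}[m0]add0n big_addn big_mkord.
    by apply: eq_bigr => i _; rewrite ut.
  by rewrite (cvg_centern m0 (fun M => \sum_(i < M) t i)).
by split; [apply/cvg_ex; exists F|rewrite (cvg_lim _ uF)].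
Qed.

Lemma expansion_crev K (c : R) m0 (u u' : nat -> C) :
  (forall m, u' m = crev (u m)) -> expansion K c m0 u ->
  expansion (crev K) c m0 u'.
Proof.
move=> uu' [/cvg_ex[F uF] ->].
have uF' : (\sum_(m0 <= m < N) u' m) @[N --> \oo] --> crev F.
  have -> : (fun N => \sum_(m0 <= m < N) u' m) =
      (fun N => crev (\sum_(m0 <= m < N) u m)).
    by apply/funext => N; rewrite linear_sum; apply: eq_bigr => m _; rewrite uu'.
  exact: cvg_twist.
split; first by apply/cvg_ex; exists (crev F).
by rewrite (cvg_lim _ uF') // (cvg_lim _ uF) // linearZ.
Qed.

Lemma crevV (a : C) : crev a^-1 = (crev a)^-1.
Proof.
have Ucrev (b : C) : b \is a GRing.unit ->
    crev b^-1 * crev b = 1 /\ crev b * crev b^-1 = 1.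
  by move=> Ub; rewrite -!crevM divrr // mulVr // crev1.
have [Ua|nUa] := boolP (a \is a GRing.unit).
  have [l r] := Ucrev _ Ua.
  have Uc : crev a \is a GRing.unit by apply/unitrP; exists (crev a^-1).
  by apply: (mulrI Uc); rewrite divrr.
rewrite (invr_out nUa) invr_out //; apply: contra nUa => Uc.
have [l r] := Ucrev _ Uc; rewrite crevK in l r.
by apply/unitrP; exists (crev (crev a)^-1).
Qed.

Lemma crevX (a : C) m : crev (a ^+ m) = crev a ^+ m.
Proof.
elim: m => [|m IH]; first by rewrite !expr0 crev1.
by rewrite exprS crevM IH exprSr.
Qed.

Lemma crev_SL s : @crev R n \o SL s = SR s.
Proof.
apply/funext => x; rewrite /= /SL /SR crevM crevV.
have -> : crev (Qc s x) = Qc s x.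
  by rewrite Qc_affine linearD !linearZ /= crev1 crev_para.
by congr (_ * _); rewrite linearB /= crev_para crev_paraconj.
Qed.

Lemma partial_crev i f : partial i (@crev R n \o f) = @crev R n \o partial i f.
Proof. by apply/funext => x; exact: derive_crev. Qed.

Lemma DR_crev f : DR (@crev R n \o f) = @crev R n \o DL f.
Proof.
apply/funext => x; rewrite /DR /DL /= linearD linear_sum partial_crev.
congr (_ + _); apply: eq_bigr => i _.
by rewrite partial_crev /= crevM crev_gen.
Qed.

Lemma DbarR_crev f : DbarR (@crev R n \o f) = @crev R n \o DbarL f.
Proof.
apply/funext => x; rewrite /DbarR /DbarL /= linearB partial_crev /=.
congr (_ - _); rewrite linear_sum; apply: eq_bigr => i _.
by rewrite partial_crev /= crevM crev_gen.
Qed.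

Lemma Lap_crev f : Lap (@crev R n \o f) = @crev R n \o Lap f.
Proof.
apply/funext => x; rewrite /Lap /= linear_sum.
by apply: eq_bigr => i _; rewrite !partial_crev.
Qed.

End Expansions.

(** * Values of the fractions *)
Section SliceExpansions.
Local Open Scope classical_set_scope.
Local Open Scope ring_scope.
Variable R : realType.
Local Notation n := 5%N.
Local Notation C := (clifford R n).
Local Notation V := 'rV[R]_n.+1.
Variables (s x : V).
Hypothesis xs : enorm x < enorm s.

Local Notation X := (para x).
Local Notation X' := (paraconj x).
Local Notation S := (para s).
Local Notation q := (Qc s x)^-1.
Local Notation num1 := (num1 s x).
Local Notation num2 := (num2 s x).
Local Notation num3 := (num3 s x).

Lemma resolve_num g k : resolve s x X' (g * q ^+ k) = sylvester s X' g * q ^+ k.+1.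
Proof.
rewrite resolveM; last exact/commr_sym/commrX.
  by rewrite /resolve -mulrA -exprS.
by apply/commr_sym/commrX/commr_sym/Qc_inv_comm.
Qed.

Lemma resolve_pair g : resolve s x X' (resolve s x X g) = g * q.
Proof. exact: (resolve_conj xs _ (conj_pair_paraconj x)). Qed.

Lemma hvalue20 : hvalue s x 2 0 = num2 * q ^+ 2.
Proof. by rewrite /hvalue /= -[1]mulr1 -[X in _ * X](expr0 q) !resolve_num. Qed.

Lemma hvalue30 : hvalue s x 3 0 = num3 * q ^+ 3.
Proof. by rewrite /hvalue /= -[1]mulr1 -[X in _ * X](expr0 q) !resolve_num. Qed.

Lemma hvalue11 : hvalue s x 1 1 = q.
Proof. by rewrite /hvalue /= resolve_pair mul1r. Qed.

Lemma hvalue21 : hvalue s x 2 1 = num1 * q ^+ 2.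
Proof. by rewrite /hvalue /= resolve_pair -[q in LHS]expr1 resolve_num. Qed.

Lemma hvalue31 : hvalue s x 3 1 = num2 * q ^+ 3.
Proof. by rewrite /hvalue /= resolve_pair -[q in LHS]expr1 !resolve_num. Qed.

Lemma hvalue12 : hvalue s x 1 2 = (S - X) * q ^+ 2.
Proof.
rewrite /hvalue /= resolve_pair /resolve /sylvester mul1r mulr1.
by rewrite -mulrA -expr2.
Qed.

Lemma hvalue22 : hvalue s x 2 2 = q ^+ 2.
Proof.
rewrite /hvalue /= resolve_pair.
rewrite (resolveM X' (resolve s x X 1) (Qc_inv_comm s x) (erefl _)).
by rewrite resolve_pair mul1r -expr2.
Qed.

End SliceExpansions.

(** * The expansions of the left kernels *)
Section LeftExpansions.
Local Open Scope classical_set_scope.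
Local Open Scope ring_scope.
Variable R : realType.
Local Notation n := 5%N.
Local Notation C := (clifford R n).
Local Notation V := 'rV[R]_n.+1.
Variables (s x : V).
Hypothesis xs : enorm x < enorm s.

Local Notation X := (para x).
Local Notation X' := (paraconj x).
Local Notation S := (para s).
Local Notation q := (Qc s x)^-1.
Local Notation v := (S^-1).

Lemma negbin1 a : negbin 1 a = 1%N.
Proof. by rewrite /negbin addn1 binn. Qed.

Lemma negbin2 a : negbin 2 a = a.+1.
Proof. by rewrite /negbin addn2 /= binSn. Qed.

Lemma negbin3 a : (2 * negbin 3 a = a.+2 * a.+1)%N.
Proof.
elim: a => [|a IH]; first by rewrite negbin0.
by rewrite negbinSS mulnDr IH negbin2; nia.
Qed.

Lemma sum_shift (V' : nmodType) (f : nat -> V') i :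
  \sum_(1 <= k < i.+2) f k = \sum_(b < i.+1) f b.+1.
Proof. by rewrite big_add1 big_mkord. Qed.

Lemma hcoefMr p r i (a : C) : hcoef x p r i * a =
  \sum_(b < i.+1) (negbin p (i - b) * negbin r b)%:R *: (X ^+ (i - b) * X' ^+ b * a).
Proof. by rewrite mulr_suml; apply: eq_bigr => b _; rewrite -scalerAl. Qed.

Lemma hcoef_pure p i : hcoef x p 0 i = (negbin p i)%:R *: X ^+ i.
Proof.
rewrite /hcoef big_ord_recl subn0 muln1 mulr1 big1 ?addr0 // => b _.
by rewrite lift0 negbin0S muln0 scale0r.
Qed.

Lemma expr_invS i m0 : S ^- (1 + (i + m0)) = v ^+ (i + m0.+1).
Proof. by rewrite exprVn add1n addnS. Qed.

Lemma expansion_D : expansion (kernelL opD s x) (- 4) 1 (fun m =>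
  \sum_(1 <= k < m.+1) X ^+ (m - k) * X' ^+ (k - 1) * S ^- (1 + m)).
Proof.
apply: (expansion_cvg _ (hseries_cvg xs 1 1)) => [i|]; last first.
  by rewrite hvalue11 // [LHS]DL_SL // mulr_algl.
rewrite expr_invS hcoefMr addn1 sum_shift; apply: eq_bigr => b _.
by rewrite !negbin1 scale1r subSS subn1.
Qed.

Lemma expansion_Lap : expansion (kernelL opLap s x) (- 8) 2 (fun m =>
  \sum_(1 <= k < m) (m - k)%:R *: (X ^+ (m - k - 1) * X' ^+ (k - 1) * S ^- (1 + m))).
Proof.
apply: (expansion_cvg _ (hseries_cvg xs 2 1)) => [i|]; last first.
  by rewrite hvalue21 // [LHS]Lap_SL // scalerAl.
rewrite expr_invS hcoefMr addn2 sum_shift; apply: eq_bigr => b _.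
have bi : (b <= i)%N by rewrite -ltnS.
by rewrite negbin1 negbin2 muln1 subSS subSn // !subn1.
Qed.

(** Stated for any element of this value, as it serves Lap after D on the left
    and D after Lap on the right. *)
Lemma expansion_LapD_at K : K = 16%:A * q ^+ 2 -> expansion K 16 3 (fun m =>
  \sum_(1 <= k < m - 1) ((m - k - 1) * k)%:R *:
    (X ^+ (m - k - 2) * X' ^+ (k - 1) * S ^- (1 + m))).
Proof.
move=> ->; apply: (expansion_cvg _ (hseries_cvg xs 2 2)) => [i|]; last first.
  by rewrite hvalue22 // mulr_algl.
rewrite expr_invS hcoefMr addn3 subn1 sum_shift; apply: eq_bigr => b _.
have bi : (b <= i)%N by rewrite -ltnS.
have -> : (i.+3 - b.+1 - 1 = (i - b).+1)%N by lia.
have -> : (i.+3 - b.+1 - 2 = i - b)%N by lia.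
by rewrite !negbin2 subn1.
Qed.

Lemma expansion_D2 : expansion (kernelL opD2 s x) (- 8) 2 (fun m =>
  \sum_(1 <= k < m) k%:R *: (X ^+ (m - k - 1) * X' ^+ (k - 1) * S ^- (1 + m))).
Proof.
apply: (expansion_cvg _ (hseries_cvg xs 1 2)) => [i|]; last first.
  by rewrite hvalue12 // [LHS]D2_SL // scalerAl.
rewrite expr_invS hcoefMr addn2 sum_shift; apply: eq_bigr => b _.
have bi : (b <= i)%N by rewrite -ltnS.
by rewrite negbin1 negbin2 mul1n subSS subSn // !subn1.
Qed.

Lemma sums_to_lincomb (k l : R) (t u : nat -> C) F G (e : nat) :
  sums_to (fun m => t m * v ^+ (m + e)) F ->
  sums_to (fun m => u m * v ^+ (m + e)) G ->
  sums_to (fun m => (k *: t m + l *: u m) * v ^+ (m + e)) (k *: F + l *: G).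
Proof.
rewrite /sums_to => tF uG.
have -> : (fun N => \sum_(m < N) (k *: t m + l *: u m) * v ^+ (m + e)) =
    (fun N => k *: (\sum_(m < N) t m * v ^+ (m + e))
            + l *: (\sum_(m < N) u m * v ^+ (m + e))).
  apply/funext => N; rewrite !scaler_sumr -big_split; apply: eq_bigr => m _.
  by rewrite mulrDl -!scalerAl.
by apply: cvgD; apply: cvgZl_tmp.
Qed.

Lemma expansion_Dbar : expansion (kernelL opDbar s x) 2 1 (fun m =>
  (m%:R *: X ^+ (m - 1) + 2 *: \sum_(1 <= k < m.+1) X ^+ (m - k) * X' ^+ (k - 1))
  * S ^- (1 + m)).
Proof.
have h := sums_to_lincomb (k := 1) (l := 2) (hseries_cvg xs 2 0) (hseries_cvg xs 1 1).
apply: (expansion_cvg _ h) => [i|]; last first.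
  rewrite hvalue20 // hvalue11 // [LHS]DbarL_SL // /numDbar mulrDl -!scalerAl.
  rewrite Qc_mulVX // expr1 scale1r.
  by apply: coordP => A; rewrite !coordE; ring.
rewrite expr_invS; congr (_ * _).
rewrite addn1 sum_shift subn1 hcoef_pure negbin2 scale1r; congr (_ + _ *: _).
by apply: eq_bigr => b _; rewrite !negbin1 scale1r subSS subn1.
Qed.

Lemma expansion_Dbar2 : expansion (kernelL opDbar2 s x) 4 2 (fun m =>
  ((m * (m - 1))%:R *: X ^+ (m - 2)
   + 2 *: \sum_(1 <= k < m) (2 * m - k)%:R *: (X ^+ (m - k - 1) * X' ^+ (k - 1)))
  * S ^- (1 + m)).
Proof.
have h := sums_to_lincomb (k := 2) (l := 2) (hseries_cvg xs 3 0)
  (sums_to_lincomb (k := 2) (l := 1) (hseries_cvg xs 2 1) (hseries_cvg xs 1 2)).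
apply: (expansion_cvg _ h) => [i|]; last first.
  rewrite hvalue30 // hvalue21 // hvalue12 // [LHS]Dbar2_SL //.
  by apply: coordP => A; rewrite !coordE; ring.
rewrite expr_invS; congr (_ * _).
rewrite addn2 sum_shift subn1 subn2 hcoef_pure scalerA -natrM negbin3.
congr (_ + _ *: _); rewrite scale1r scaler_sumr -big_split.
apply: eq_bigr => b _; have bi : (b <= i)%N by rewrite -ltnS.
rewrite /= !negbin1 !negbin2 muln1 mul1n scalerA -natrM -scalerDl -natrD.
by congr (_%:R *: (_ ^+ _ * _ ^+ _)); lia.
Qed.

(** The coefficient (m-k-1)(m+k) is that of 2 / ((s-x)^3 (s-xb)) plus that of
    2 / ((s-x)^2 (s-xb)^2): with a = m-k-2 and b = k-1 it equals
    (a+1)(a+2) + 2 (a+1)(b+1). *)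
Lemma expansion_LapDbar_at K : K = - 32 *: (q ^+ 2 + num2 s x * q ^+ 3) ->
  expansion K (- 16) 3 (fun m =>
  \sum_(1 <= k < m - 1) ((m - k - 1) * (m + k))%:R *:
    (X ^+ (m - k - 2) * X' ^+ (k - 1) * S ^- (1 + m))).
Proof.
move=> ->; have h := sums_to_lincomb (k := 2) (l := 2) (hseries_cvg xs 3 1)
  (hseries_cvg xs 2 2).
apply: (expansion_cvg _ h) => [i|]; last first.
  rewrite hvalue31 // hvalue22 //.
  by apply: coordP => A; rewrite !coordE; ring.
rewrite expr_invS mulrDl -!scalerAl !hcoefMr !scaler_sumr -big_split.
rewrite addn3 subn1 sum_shift; apply: eq_bigr => b _.
have bi : (b <= i)%N by rewrite -ltnS.
rewrite /= !scalerA -!natrM -scalerDl -natrD.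
rewrite negbin1 !negbin2 muln1 negbin3.
have -> : (i.+3 - b.+1 - 1 = (i - b).+1)%N by lia.
have -> : (i.+3 + b.+1 = (i - b).+2 + 2 * b.+1)%N by lia.
have -> : (i.+3 - b.+1 - 2 = i - b)%N by lia.
by rewrite subn1; congr (_%:R *: _); lia.
Qed.

End LeftExpansions.

Theorem lemma7p20 (R : realType) (s x : 'rV[R]_6) (hxs : enorm x < enorm s) :
  (expansion (kernelL opD s x) (- 4) 1 (fun m =>
     \sum_(1 <= k < m.+1)
       para x ^+ (m - k) * paraconj x ^+ (k - 1) * para s ^- (1 + m))
   /\
   expansion (kernelR opD s x) (- 4) 1 (fun m =>
     \sum_(1 <= k < m.+1)
       para s ^- (1 + m) * para x ^+ (m - k) * paraconj x ^+ (k - 1)))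
  /\
  (expansion (kernelL opLap s x) (- 8) 2 (fun m =>
     \sum_(1 <= k < m)
       (m - k)%:R *: (para x ^+ (m - k - 1) * paraconj x ^+ (k - 1)
                      * para s ^- (1 + m)))
   /\
   expansion (kernelR opLap s x) (- 8) 2 (fun m =>
     \sum_(1 <= k < m)
       (m - k)%:R *: (para s ^- (1 + m) * para x ^+ (m - k - 1)
                      * paraconj x ^+ (k - 1))))
  /\
  (expansion (kernelL opLapD s x) 16 3 (fun m =>
     \sum_(1 <= k < m - 1)
       ((m - k - 1) * k)%:R *: (para x ^+ (m - k - 2) * paraconj x ^+ (k - 1)
                                * para s ^- (1 + m)))
   /\
   expansion (kernelR opLapD s x) 16 3 (fun m =>
     \sum_(1 <= k < m - 1)
       ((m - k - 1) * k)%:R *: (para s ^- (1 + m) * para x ^+ (m - k - 2)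
                                * paraconj x ^+ (k - 1))))
  /\
  (expansion (kernelL opD2 s x) (- 8) 2 (fun m =>
     \sum_(1 <= k < m)
       k%:R *: (para x ^+ (m - k - 1) * paraconj x ^+ (k - 1)
                * para s ^- (1 + m)))
   /\
   expansion (kernelR opD2 s x) (- 8) 2 (fun m =>
     \sum_(1 <= k < m)
       k%:R *: (para s ^- (1 + m) * para x ^+ (m - k - 1)
                * paraconj x ^+ (k - 1))))
  /\
  (expansion (kernelL opDbar s x) 2 1 (fun m =>
     (m%:R *: para x ^+ (m - 1)
      + 2 *: \sum_(1 <= k < m.+1) para x ^+ (m - k) * paraconj x ^+ (k - 1))
     * para s ^- (1 + m))
   /\
   expansion (kernelR opDbar s x) 2 1 (fun m =>
     para s ^- (1 + m)
     * (m%:R *: para x ^+ (m - 1)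
        + 2 *: \sum_(1 <= k < m.+1) para x ^+ (m - k) * paraconj x ^+ (k - 1))))
  /\
  (expansion (kernelL opDbar2 s x) 4 2 (fun m =>
     ((m * (m - 1))%:R *: para x ^+ (m - 2)
      + 2 *: \sum_(1 <= k < m)
               (2 * m - k)%:R *: (para x ^+ (m - k - 1) * paraconj x ^+ (k - 1)))
     * para s ^- (1 + m))
   /\
   expansion (kernelR opDbar2 s x) 4 2 (fun m =>
     para s ^- (1 + m)
     * ((m * (m - 1))%:R *: para x ^+ (m - 2)
        + 2 *: \sum_(1 <= k < m)
                 (2 * m - k)%:R *: (para x ^+ (m - k - 1)
                                    * paraconj x ^+ (k - 1)))))
  /\
  (expansion (kernelL opLapDbar s x) (- 16) 3 (fun m =>
     \sum_(1 <= k < m - 1)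
       ((m - k - 1) * (m + k))%:R *: (para x ^+ (m - k - 2)
                                      * paraconj x ^+ (k - 1)
                                      * para s ^- (1 + m)))
   /\
   expansion (kernelR opLapDbar s x) (- 16) 3 (fun m =>
     \sum_(1 <= k < m - 1)
       ((m - k - 1) * (m + k))%:R *: (para s ^- (1 + m) * para x ^+ (m - k - 2)
                                      * paraconj x ^+ (k - 1)))).
Proof.
have rev u : crev (para s ^- u) = para s ^- u.
  by rewrite crevV crevX crev_para.
have revX (a b : nat) : crev (para x ^+ a * paraconj x ^+ b) =
    para x ^+ a * paraconj x ^+ b.
  rewrite crevM !crevX crev_para crev_paraconj.
  by apply/commrX/commr_sym/commrX; exact: para_comm.
have revT (a b u : nat) : crev (para x ^+ a * paraconj x ^+ b * para s ^- u) =
    para s ^- u * para x ^+ a * paraconj x ^+ b.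
  by rewrite crevM rev revX mulrA.
have revS m0 N (k : nat -> R) (a b u : nat -> nat) :
    \sum_(m0 <= j < N) k j *: (para s ^- u j * para x ^+ a j * paraconj x ^+ b j) =
    crev (\sum_(m0 <= j < N) k j *: (para x ^+ a j * paraconj x ^+ b j * para s ^- u j)).
  by rewrite linear_sum; apply: eq_bigr => j _; rewrite linearZ /= revT.
have rev1 (a : nat) : crev (para x ^+ a) = para x ^+ a by rewrite crevX crev_para.
split; [|split; [|split; [|split; [|split; [|split]]]]]; split.
- exact: expansion_D.
- rewrite /kernelR /actR -crev_SL DR_crev; apply: expansion_crev (expansion_D hxs).
  by move=> m; rewrite linear_sum; apply: eq_bigr => k _; rewrite /= revT.
- exact: expansion_Lap.
- rewrite /kernelR /actR -crev_SL Lap_crev; apply: expansion_crev (expansion_Lap hxs).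
  by move=> m; exact: revS.
- exact/expansion_LapD_at/LapDL_SL.
- rewrite /kernelR /actR -crev_SL Lap_crev DR_crev.
  apply: expansion_crev (expansion_LapD_at hxs (DLLap_SL hxs)).
  by move=> m; exact: revS.
- exact: expansion_D2.
- rewrite /kernelR /actR -crev_SL !DR_crev; apply: expansion_crev (expansion_D2 hxs).
  by move=> m; exact: revS.
- exact: expansion_Dbar.
- rewrite /kernelR /actR -crev_SL DbarR_crev.
  apply: expansion_crev (expansion_Dbar hxs) => m.
  rewrite crevM rev linearD !linearZ /= rev1.
  by congr (_ * (_ + _ *: _)); rewrite linear_sum; apply: eq_bigr => k _; rewrite /= revX.
- exact: expansion_Dbar2.
- rewrite /kernelR /actR -crev_SL !DbarR_crev.
  apply: expansion_crev (expansion_Dbar2 hxs) => m.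
  rewrite crevM rev linearD !linearZ /= rev1.
  congr (_ * (_ + _ *: _)); rewrite linear_sum.
  by apply: eq_bigr => k _; rewrite linearZ /= revX.
- exact/expansion_LapDbar_at/LapDbar_SL.
- rewrite /kernelR /actR -crev_SL Lap_crev DbarR_crev.
  apply: expansion_crev (expansion_LapDbar_at hxs (DbarLap_SL hxs)).
  by move=> m; exact: revS.
Qed.
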